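(* Assume that there exist $\gamma>0$, $\rho<0$ and a function $A$ with $A(t)\to0$ as $t\to+\infty$ such that, for all $\omega>0$, $$\lim_{t\to+\infty}\frac{1}{A(t)}\left(\frac{\Phi_R^{-1}\left(1-\frac{1}{\omega t}\right)}{\Phi_R^{-1}\left(1-\frac1t\right)}-\omega^{\gamma}\right)=\omega^{\gamma}\,\frac{\omega^{\rho}-1}{\rho}.$$ Then there exist $\eta\in\mathbb{R}$ and $0<\ell<+\infty$ such that $$\lim_{t\to+\infty}\frac{\bar\Phi_{R^*}(t)}{\bar\Phi_R(t^{\eta})}=\ell,$$ and they are given by $$\eta=1+\gamma N,\qquad \ell=\frac{\Gamma\left(\frac{N+\gamma^{-1}+1}{2}\right)}{\Gamma\left(\frac{\gamma^{-1}+1}{2}\right)}\,\frac{\gamma^{-1}\pi^{-N/2}}{(N+\gamma^{-1})\,c_N g_N(M(x))}.$$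
   Context: Fix an integer $N\ge1$. For $d\ge1$, $\chi_d$ is the square root of a $\chi^2$ variable with $d$ degrees of freedom, $U^{(d)}$ is uniform on the unit sphere of $\mathbb{R}^d$ (so $U^{(1)}=\pm1$ with probability $1/2$ each), $\xi$ is a non-negative random variable whose law does not depend on $d$, and $\chi_d,\xi,U^{(d)}$ are mutually independent; $R_d=\chi_d\xi$. A random vector $Z\in\mathbb{R}^d$ is $(\xi,d)$-elliptical with parameters $\mu,\Sigma$ if $Z\overset{d}{=}\mu+R_d\Lambda U^{(d)}$ with $\Lambda\Lambda^T=\Sigma$. Densities are assumed to exist ($\Sigma$ positive definite); the density is written $\frac{c_d}{|\Sigma|^{1/2}}g_d\left((z-\mu)^T\Sigma^{-1}(z-\mu)\right)$, with $c_d$ the normalization coefficient and $g_d$ the generator. $(X,Y)$, with $X\in\mathbb{R}^N$, $Y\in\mathbb{R}$, is $(\xi,N+1)$-elliptical with parameters $\mu=(\mu_X,\mu_Y)$ and $\Sigma$ with blocks $\Sigma_X,\Sigma_{XY},\Sigma_Y$. Fix $x\in\mathbb{R}^N$ and put $M(x)=(x-\mu_X)^T\Sigma_X^{-1}(x-\mu_X)$, with $0<c_Ng_N(M(x))<+\infty$. The conditional law of $Y$ given $X=x$ is that of $\mu_{Y|X}+\sigma_{Y|X}R^*U^{(1)}$, with $\mu_{Y|X}=\mu_Y+\Sigma_{XY}^T\Sigma_X^{-1}(x-\mu_X)$, $\sigma_{Y|X}^2=\Sigma_Y-\Sigma_{XY}^T\Sigma_X^{-1}\Sigma_{XY}$,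 where $R^*\ge0$ is independent of $U^{(1)}$ and $R^*U^{(1)}$ has density $t\mapsto c_{N+1}g_{N+1}(M(x)+t^2)/(c_Ng_N(M(x)))$. $\Phi_R(t)=\mathbb{P}(R_1U^{(1)}\le t)$, $\Phi_{R^*}(t)=\mathbb{P}(R^*U^{(1)}\le t)$, $\bar\Phi=1-\Phi$, and $\Phi^{-1}$ denotes the quantile function. *)

(* Defs.v *)
From HB Require Import structures.
From mathcomp Require Import all_boot all_order all_algebra.
From mathcomp Require Import all_classical all_reals all_analysis.
From mathcomp Require Import measurable_realfun.

Set Implicit Arguments.
Unset Strict Implicit.
Unset Printing Implicit Defensive.

Import Order.TTheory GRing.Theory Num.Theory.
Import numFieldNormedType.Exports.

Local Open Scope classical_set_scope.
Local Open Scope ring_scope.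

(* The sigma-algebra on column vectors is generated by the coordinates, exactly
   as the library does for n.-tuple T. *)
Section measurable_cV.
Context {d} {T : measurableType d}.
Variable n : nat.

Let coors : 'I_n -> 'cV[T]_n -> T := fun i v => v i ord0.

Let cV_set0 : g_sigma_preimage coors set0.
Proof. exact: sigma_algebra0. Qed.

Let cV_setC A : g_sigma_preimage coors A -> g_sigma_preimage coors (~` A).
Proof. exact: sigma_algebraC. Qed.

Let cV_bigcup (F : _^nat) : (forall i, g_sigma_preimage coors (F i)) ->
  g_sigma_preimage coors (\bigcup_i (F i)).
Proof. exact: sigma_algebra_bigcup. Qed.

HB.instance Definition _ := @isMeasurable.Build (measure_tuple_display d)
  'cV[T]_n (g_sigma_preimage coors) cV_set0 cV_setC cV_bigcup.

End measurable_cV.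

Section measurable_cV_theory.
Context d1 d2 (T1 : measurableType d1) (T2 : measurableType d2).

Lemma measurable_coord n (i : 'I_n) (j : 'I_1) :
  measurable_fun [set: 'cV[T2]_n] (fun v : 'cV[T2]_n => v i j).
Proof.
rewrite ord1 => _ Y mY; rewrite setTI; apply: sub_sigma_algebra => /=.
rewrite -bigcup_seq/=; exists i => /=; first by rewrite mem_index_enum.
by exists Y => //; rewrite setTI.
Qed.

Lemma measurable_fun_cVP n (f : T1 -> 'cV[T2]_n) :
  measurable_fun [set: T1] f <->
  forall i, measurable_fun [set: T1] (fun x => f x i ord0).
Proof.
split=> [mf i|mf].
  exact: (measurableT_comp (measurable_coord i ord0) mf).
move=> _ Y mY; rewrite setTI.
have mS : sigma_algebra [set: 'cV[T2]_n] [set A | measurable (f @^-1` A)].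
  split => /=.
  - by rewrite preimage_set0.
  - by move=> A mA; rewrite setTD preimage_setC; exact: measurableC.
  - by move=> F mF; rewrite preimage_bigcup; exact: bigcupT_measurable.
move: Y mY; apply: smallest_sub => //.
elim/big_ind : _ => //= [|i _ A [B mB <-]].
  by move=> A B sA sB; rewrite subUset.
by rewrite /= setTI -[X in measurable X]setTI; exact: mf.
Qed.

End measurable_cV_theory.

Section cV_measures.
Context {R : realType}.

(* R^(n+1) is identified with R * R^n. *)
Definition cons_cV n (xv : measurableTypeR R * 'cV[R]_n) : 'cV[R]_n.+1 :=
  col_mx (xv.1)%:M xv.2.

Lemma measurable_cons_cV n : measurable_fun setT (@cons_cV n).
Proof.
apply/measurable_fun_cVP => i; rewrite /cons_cV.
have [j ->|j ->] := @split_ordP 1 n i.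
- rewrite ord1 (_ : (fun _ => _) = fst)//.
  apply/funext => x; apply: etrans (@col_mxEu _ 1 n 1 _ _ _ _) _.
  by rewrite mxE eqxx mulr1n.
- rewrite (_ : (fun _ => _) = (fun v : 'cV[R]_n => v j ord0) \o snd); last first.
    by apply/funext => x; exact: (@col_mxEd _ 1 n 1).
  exact: measurableT_comp (measurable_coord j ord0) measurable_snd.
Qed.

HB.instance Definition _ n :=
  isMeasurableFun.Build _ _ _ _ (@cons_cV n) (@measurable_cons_cV n).

Section pushforward_cons.
Variables (n : nat)
  (mu : {sigma_finite_measure set (measurableTypeR R) -> \bar R})
  (nu : {sigma_finite_measure set 'cV[R]_n -> \bar R}).

Definition cons_measure : set 'cV[R]_n.+1 -> \bar R :=
  pushforward (mu \x nu)%E (@cons_cV n).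

Let cons_measure0 : cons_measure set0 = 0%E.
Proof. by rewrite /cons_measure /pushforward preimage_set0 measure0. Qed.

Let cons_measure_ge0 A : (0 <= cons_measure A)%E.
Proof. exact: measure_ge0. Qed.

Let cons_measure_sigma_additive : semi_sigma_additive cons_measure.
Proof.
have mcons A : measurable A -> measurable (@cons_cV n @^-1` A).
  by move=> mA; rewrite -[X in measurable X]setTI; exact: measurable_cons_cV.
move=> F mF tF mUF; rewrite /cons_measure /pushforward preimage_bigcup.
apply: measure_semi_sigma_additive.
- by move=> k; exact: mcons.
- apply/trivIsetP => /= i j _ _ ij; rewrite -preimage_setI.
  by move/trivIsetP : tF => /(_ _ _ _ _ ij) ->//; rewrite preimage_set0.
- by rewrite -preimage_bigcup; exact: mcons.
Qed.

HB.instance Definition _ := isMeasure.Build _ _ _ cons_measure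
  cons_measure0 cons_measure_ge0 cons_measure_sigma_additive.

Lemma sigma_finite_cons_measure : sigma_finite setT cons_measure.
Proof.
have [F TF Foo] : sigma_finite setT (mu \x nu)%E.
  have /sigma_finiteP[F [TF ndF Foo]] := sigma_finiteT mu.
  have /sigma_finiteP[G [TG ndG Goo]] := sigma_finiteT nu.
  exists (fun n => F n `*` G n).
    rewrite -setXTT TF TG predeqE => -[x y]; split.
      move=> [/= [i _ Fix] [k _ Gky]]; exists (maxn i k) => //; split.
      - by move: x Fix; exact/subsetPset/ndF/leq_maxl.
      - by move: y Gky; exact/subsetPset/ndG/leq_maxr.
    by move=> [i _ []/= ? ?]; split; exists i.
  move=> k; have [? ?] := Foo k; have [? ?] := Goo k.
  split; first exact: measurableX.
  by rewrite product_measure1E// lte_mul_pinfty// ge0_fin_numE.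
pose unc (v : 'cV[R]_n.+1) : measurableTypeR R * 'cV[R]_n :=
  (v ord0 ord0, \col_i v (lift ord0 i) ord0).
have uncK v : cons_cV (unc v) = v.
  apply/matrixP => i j; rewrite ord1 /cons_cV.
  have [k ->|k ->] := @split_ordP 1 n i.
    apply: etrans (@col_mxEu _ 1 n 1 _ _ _ _) _.
    by rewrite ord1 mxE eqxx mulr1n; congr (v _ _); exact/val_inj.
  apply: etrans (@col_mxEd _ 1 n 1 _ _ _ _) _.
  by rewrite mxE; congr (v _ _); exact/val_inj.
have cK : cancel (@cons_cV n) unc.
  case=> x v; rewrite /unc; congr pair.
    rewrite /cons_cV (_ : ord0 = @lshift 1 n ord0); last exact/val_inj.
    by apply: etrans (@col_mxEu _ 1 n 1 _ _ _ _) _; rewrite mxE eqxx mulr1n.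
  apply/colP => i; rewrite mxE (_ : lift ord0 i = @rshift 1 n i);
    last exact/val_inj.
  exact: (@col_mxEd _ 1 n 1).
have munc : measurable_fun setT unc.
  apply/measurable_fun_pairP; split => /=.
    exact: (measurable_coord ord0 ord0).
  apply/measurable_fun_cVP => i.
  rewrite (_ : (fun _ => _) = fun v : 'cV[R]_n.+1 => v (lift ord0 i) ord0).
    exact: measurable_coord.
  by apply/funext => v; rewrite mxE.
exists (fun i => unc @^-1` (F i)).
  by rewrite -preimage_bigcup -TF preimage_setT.
move=> i; have [mF Fy] := Foo i; split.
  by rewrite -[X in measurable X]setTI; exact: munc.
rewrite /cons_measure /pushforward -comp_preimage (_ : _ \o _ = id)//.
by apply/funext => x /=; rewrite cK.
Qed.

HB.instance Definition _ :=
  Measure_isSigmaFinite.Build _ _ _ cons_measure sigma_finite_cons_measure.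

End pushforward_cons.

Fixpoint power_measure
    (mu : {sigma_finite_measure set (measurableTypeR R) -> \bar R}) n :
    {sigma_finite_measure set 'cV[R]_n -> \bar R} :=
  if n is m.+1 then cons_measure mu (power_measure mu m)
  else \d_(0 : 'cV[R]_0).

Definition lebesgue_cV n := power_measure (@lebesgue_measure R) n.

End cV_measures.

Section analysis_notions.
Context {R : realType}.

Definition Gamma (a : R) : R :=
  \int[lebesgue_measure]_(t in `]0, +oo[) (t `^ (a - 1) * expR (- t)).

Definition quantile (F : R -> R) (p : R) : R := inf [set t | p <= F t].

Definition posdefmx n (S : 'M[R]_n) : Prop :=
  S^T = S /\ forall v : 'cV[R]_n, v != 0 -> 0 < (v^T *m S *m v) ord0 ord0.

Definition mahalanobis n (mu : 'cV[R]_n) (S : 'M[R]_n) (z : 'cV[R]_n) : R :=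
  ((z - mu)^T *m invmx S *m (z - mu)) ord0 ord0.

(* chi-squared law: law of the sum of the squares of d independent N(0,1) *)
Definition chi2_prob d : set R -> \bar R :=
  pushforward (power_measure (normal_prob (0 : R) 1) d)
    (fun z : 'cV[R]_d => \sum_i z i ord0 ^+ 2).

End analysis_notions.

Section random_vectors.
Context {R : realType} {dO} {Omega : measurableType dO}
  (P : probability Omega R).

Definition Phi (V : Omega -> R) (t : R) : R := fine (P [set w | V w <= t]).

Definition has_density d (T : measurableType d) (V : Omega -> T)
    (mu : set T -> \bar R) (f : T -> \bar R) : Prop :=
  forall B, measurable B -> P (V @^-1` B) = (\int[mu]_(z in B) f z)%E.

Definition eq_law d (T : measurableType d) (V W : Omega -> T) : Prop :=
  forall B, measurable B -> P (V @^-1` B) = P (W @^-1` B).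

Definition independent2 d1 d2 (T1 : measurableType d1) (T2 : measurableType d2)
    (V1 : Omega -> T1) (V2 : Omega -> T2) : Prop :=
  forall B1 B2, measurable B1 -> measurable B2 ->
  P (V1 @^-1` B1 `&` V2 @^-1` B2) = (P (V1 @^-1` B1) * P (V2 @^-1` B2))%E.

(* Taking some of the sets full gives the product rule for subfamilies. *)
Definition independent3 d1 d2 d3 (T1 : measurableType d1)
    (T2 : measurableType d2) (T3 : measurableType d3)
    (V1 : Omega -> T1) (V2 : Omega -> T2) (V3 : Omega -> T3) : Prop :=
  forall B1 B2 B3, measurable B1 -> measurable B2 -> measurable B3 ->
  P (V1 @^-1` B1 `&` V2 @^-1` B2 `&` V3 @^-1` B3) =
  (P (V1 @^-1` B1) * P (V2 @^-1` B2) * P (V3 @^-1` B3))%E.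

Definition chi_distributed d (V : Omega -> R) : Prop :=
  forall B : set R, measurable B ->
  P (V @^-1` B) = chi2_prob d (Num.sqrt @^-1` B).

(* The uniform law on the unit sphere is its O(d)-invariant probability. *)
Definition uniform_sphere d (V : Omega -> 'cV[R]_d) : Prop :=
  {ae P, forall w, \sum_i V w i ord0 ^+ 2 = 1} /\
  forall O : 'M[R]_d, O *m O^T = 1%:M -> eq_law (fun w => O *m V w) V.

Record radial_model (chi : nat -> {RV P >-> R}) (xi : {RV P >-> R})
    (U : forall d, {RV P >-> 'cV[R]_d}) : Prop := RadialModel {
  radial_chi : forall d, (0 < d)%N -> chi_distributed d (chi d) ;
  radial_xi : forall w, 0 <= xi w ;
  radial_sphere : forall d, (0 < d)%N -> uniform_sphere (U d) ;
  radial_independent : forall d, (0 < d)%N -> independent3 (chi d) xi (U d)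
}.

Section elliptical.
Variables (chi : nat -> {RV P >-> R}) (xi : {RV P >-> R})
  (U : forall d, {RV P >-> 'cV[R]_d}).

Definition radius d (w : Omega) : R := chi d w * xi w.

Definition elliptical d (mu : 'cV[R]_d) (S : 'M[R]_d)
    (Z : Omega -> 'cV[R]_d) : Prop :=
  exists2 L : 'M[R]_d, L *m L^T = S &
    eq_law Z (fun w => mu + radius d w *: (L *m U d w)).

Definition elliptical_density (c : nat -> R) (g : nat -> R -> \bar R) d
    (mu : 'cV[R]_d) (S : 'M[R]_d) (z : 'cV[R]_d) : \bar R :=
  ((c d / Num.sqrt (\det S))%:E * g d (mahalanobis mu S z))%E.

(* g d may be infinite at some points (typically at 0, if g d is unbounded). *)
Record density_generators (c : nat -> R) (g : nat -> R -> \bar R) : Prop :=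
    DensityGenerators {
  generator_coef : forall d, (0 < d)%N -> 0 < c d ;
  generator_ge0 : forall d u, (0 < d)%N -> 0 <= u -> (0 <= g d u)%E ;
  generator_measurable : forall d, (0 < d)%N ->
    measurable_fun (`[0, +oo[ : set R) (g d) ;
  generator_density : forall d (mu : 'cV[R]_d) (S : 'M[R]_d)
      (Z : {RV P >-> 'cV[R]_d}), (0 < d)%N -> posdefmx S ->
    elliptical mu S Z ->
    has_density Z (lebesgue_cV d) (elliptical_density c g mu S)
}.

(* R_1 U^(1) as a real random variable: 'cV_1 has the single entry (0, 0). *)
Definition elliptical1 (w : Omega) : R := radius 1 w * U 1 w ord0 ord0.

End elliptical.

End random_vectors.

Section conditioning.
Context {R : realType} (N : nat).
Variables (muX : 'cV[R]_N) (muY : R)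
  (SX : 'M[R]_N) (SXY : 'cV[R]_N) (SY : R).

Definition joint_mean : 'cV[R]_(N + 1) := col_mx muX muY%:M.

Definition joint_scatter : 'M[R]_(N + 1) := block_mx SX SXY SXY^T SY%:M.

Definition cond_mean (x : 'cV[R]_N) : R :=
  muY + (SXY^T *m invmx SX *m (x - muX)) ord0 ord0.

Definition cond_scale : R :=
  Num.sqrt (SY - (SXY^T *m invmx SX *m SXY) ord0 ord0).

(* density of Y given X = x: joint density over marginal density *)
Definition cond_density (c : nat -> R) (g : nat -> R -> \bar R)
    (x : 'cV[R]_N) (y : R) : \bar R :=
  (elliptical_density c g joint_mean joint_scatter (col_mx x y%:M) *
   ((fine (elliptical_density c g muX SX x))^-1)%:E)%E.

End conditioning.

(* Main.v *)
(** The second-order condition forces the quantile at 1 - 1/t to be exactly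
    equivalent to a multiple of t^gamma, so that 1 - Phi_R t is equivalent to
    lam t^(-alpha) with alpha = 1 / gamma. The chi variable being the norm of a
    Gaussian vector, R_d^2 has, with respect to the image of Lebesgue measure
    by the squared norm, the density
    h_d u = pi^(-d/2) E[S^(d/2) exp(-u S)] with S = 1 / (2 xi^2), so h_d is
    a.e. the generator c_d g_d. Since h_1 decreases, the tail of Phi_R
    determines that of h_1. One passes from E[S^a exp(-u S)] to
    E[S^(a+1) exp(-u S)] by monotone density again (the second is minus the
    derivative of the first), and from exponent a + 1/2 back to a by
    integration against s^(-1/2) ds along u + s. Both steps applied to Lebesgue
    measure in place of the law of S give the corresponding facts on Gamma,
    hence the constants; this yields h_(N+1) for every N. Integrating
    h_(N+1) (M(x) + s^2) over s > t gives the tail of R* U. *)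
From Pilot Require Import Defs.
From HB Require Import structures.
From mathcomp Require Import all_boot all_order all_algebra.
From mathcomp Require Import all_classical all_reals all_analysis.
From mathcomp Require Import measurable_realfun.
From mathcomp Require Import ring lra.

Set Implicit Arguments.
Unset Strict Implicit.
Unset Printing Implicit Defensive.

Import Order.TTheory GRing.Theory Num.Theory.
Import numFieldNormedType.Exports.

Local Open Scope classical_set_scope.
Local Open Scope ring_scope.

(** * Second-order condition and tail of the distribution *)

Section second_order_condition.
Variable R : realType.
Implicit Types (q A D L : R -> R).

(** The two tails are compared at different arguments, t and t^eta. A slowly varying factor in the
    tail of Phi_R would be evaluated at two scales and need not cancel; a genuine constant does
    cancel, and so the limit retains no trace of [lam]. The exponent is then forced: R* U decays
    like t^(-(N + alpha)) and R_1 U like t^(-alpha), so eta alpha = N + alpha. The factor c_N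
    g_N(M(x)) enters through the normalization of the conditional density, the quotient of Gammas
    through the passage from h_1 to h_(N+1).

    The delicate point is that densities determine generators only up to null sets, whereas the law
    of R* U is described by g_(N+1) at the points M(x) + t^2. An exceptional set that is null for
    the image of Lebesgue measure on R^(N+1) by the squared norm must be shown to be null along this
    curve. Fubini gives one r for which it is null along s^2 + r; translations and the change of
    variables s |s| carry this over to M(x) + t^2 for large t, without polar coordinates. *)

Lemma near_pinftyP (Q : R -> Prop) :
  (\forall t \near +oo, Q t) <-> exists T, forall t, T <= t -> Q t.
Proof.
split=> [[M [_ MQ]]|[T TQ]].
  by exists (M + 1) => t Mt; apply: MQ; lra.
by exists T; split; [exact: num_real|move=> t /ltW; exact: TQ].
Qed.

Lemma cvg_near_eq (T : Type) (U : topologicalType) (F : set_system T)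
    {FF : Filter F} (f g : T -> U) (l : U) :
  (\forall x \near F, f x = g x) -> f @ F --> l -> g @ F --> l.
Proof. by move=> fg; apply: cvg_trans; apply: near_eq_cvg. Qed.

Lemma near_pinfty_scale (Q : R -> Prop) (k : R) : 0 < k ->
  (\forall t \near +oo, Q t) -> \forall t \near +oo, Q (k * t).
Proof.
move=> k0 /near_pinftyP[T TQ]; apply/near_pinftyP; exists (T / k) => t Tt.
by apply: TQ; rewrite mulrC -ler_pdivrMr.
Qed.

Lemma cvgy_scale (U : topologicalType) (f : R -> U) (F : set_system U) (k : R) :
  0 < k -> f @ +oo --> F -> f (k * t) @[t --> +oo] --> F.
Proof. by move=> k0 fF; apply: cvg_trans fF => B; exact: near_pinfty_scale. Qed.

(* Along t, 2t, 4t, ... the increments of L decay geometrically; since L (k t)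
   and L t are asymptotic for each fixed k, the limits obtained from different
   starting points t coincide. *)
Lemma cvg_dyadic L D (theta T : R) : 0 < T -> 0 <= theta < 1 ->
  (forall t, T <= t -> D (2 * t) <= theta * D t) ->
  (forall t, T <= t -> `|L (2 * t) - L t| <= D t) ->
  (forall k : R, 0 < k -> L (k * t) - L t @[t --> +oo] --> 0) ->
  D t @[t --> +oo] --> 0 -> exists l : R, L t @[t --> +oo] --> l.
Proof.
move=> T0 /andP[th0 th1] HD HL Hk D0.
have two_ge k : 1 <= 2 ^+ k :> R by rewrite exprn_ege1//; lra.
have ge2 s k : T <= s -> T <= 2 ^+ k * s.
  move=> Ts; apply: (le_trans Ts); rewrite ler_peMl//.
  exact: le_trans (ltW T0) Ts.
have Dge s : T <= s -> 0 <= D s by move=> /HL; exact: le_trans.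
have Dk s k : T <= s -> D (2 ^+ k * s) <= theta ^+ k * D s.
  move=> Ts; elim: k => [|k IH]; first by rewrite !expr0 !mul1r.
  rewrite exprS -mulrA (le_trans (HD _ _))// ?ge2//.
  by rewrite exprS -mulrA ler_wpM2l.
(* The increments telescope into a geometric sum of ratio [theta], whence a bound uniform in [k]. *)
have Lk s k : T <= s -> `|L (2 ^+ k * s) - L s| <= D s / (1 - theta).
  move=> Ts.
  suff: `|L (2 ^+ k * s) - L s| <= (1 - theta ^+ k) * (D s / (1 - theta)).
    move=> /le_trans; apply; rewrite ler_piMl//.
      by rewrite divr_ge0 ?Dge//; lra.
    by rewrite lerBlDr lerDl exprn_ge0.
  elim: k => [|k IH]; first by rewrite !expr0 mul1r !subrr mul0r normr0.
  have := HL _ (ge2 _ k Ts); have := Dk s k Ts => H1 H2.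
  rewrite exprS -mulrA.
  have -> : L (2 * (2 ^+ k * s)) - L s =
    (L (2 * (2 ^+ k * s)) - L (2 ^+ k * s)) + (L (2 ^+ k * s) - L s) by ring.
  apply: (le_trans (ler_normD _ _)); apply: (le_trans (lerD (le_trans H2 H1) IH)).
  rewrite le_eqVlt; apply/orP; left; apply/eqP; rewrite exprS; field.
  by rewrite subr_eq0 gt_eqF.
have D0' : D t / (1 - theta) @[t --> +oo] --> 0.
  by rewrite -[X in _ --> X](mul0r (1 - theta)^-1); apply: cvgMl.
have cvg2 s : T <= s -> 2 ^+ k * s @[k --> \oo] --> +oo.
  move=> Ts; have s0 : 0 < s := lt_le_trans T0 Ts.
  apply/cvgryPge => B; near=> k.
  have : B / s <= k%:R by near: k; exact: nbhs_infty_ger.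
  rewrite ler_pdivrMr// => /le_trans; apply; rewrite ler_wpM2r ?ltW//.
  have : (k < 2 ^ k)%N by rewrite ltn_expl.
  by rewrite -(natrX _ 2) ltr_nat.
have cu : cvg (L (2 ^+ k * T) @[k --> \oo]).
  apply: cauchy_cvg; apply: cauchy_exP => e e0.
  have : (D t / (1 - theta)) @[t --> +oo] --> 0 by [].
  move=> /cvgrPdist_lt /(_ _ e0) He.
  have /cvg2 HT : T <= T by [].
  have {}He := HT _ He; have [K _ HK] := He.
  exists (L (2 ^+ K * T)); exists K => // k /= Kk.
  rewrite /ball/= distrC -(subnK Kk) exprD -mulrA.
  have TK : T <= 2 ^+ K * T by rewrite ge2.
  apply: (le_lt_trans (Lk _ _ TK)).
  have /= := HK K (leqnn _); rewrite sub0r normrN ger0_norm//.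
  by rewrite divr_ge0 ?Dge//; lra.
have /cvg_ex[l ul] := cu; exists l.
have key s : T <= s -> `|l - L s| <= D s / (1 - theta).
  move=> Ts; have s0 : 0 < s := lt_le_trans T0 Ts.
  have vl : L (2 ^+ k * s) @[k --> \oo] --> l.
    have H := Hk _ (divr_gt0 s0 T0).
    have /cvg2 HT : T <= T by [].
    have {}H := cvg_comp _ _ HT H.
    rewrite -[l]add0r; apply: cvg_near_eq (cvgD H ul); near=> k => /=.
    rewrite subrK; congr L; field; by rewrite gt_eqF.
  have vn : `|L (2 ^+ k * s) - L s| @[k --> \oo] --> `|l - L s|.
    by apply: cvg_norm; apply: cvgB vl _; exact: cvg_cst.
  rewrite -(cvg_lim _ vn)//; apply: limr_le; first by apply/cvg_ex; exists `|l - L s|.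
  by near=> k; exact: Lk.
apply/cvgrPdist_le => e e0; near=> t.
apply: (@le_trans _ _ (D t / (1 - theta))).
  by apply: key; near: t; apply: nbhs_pinfty_ge; exact: num_real.
near: t; move/cvgrPdist_le : D0' => /(_ _ e0); apply: filterS => t /=.
by rewrite sub0r normrN => /(le_trans (ler_norm _)).
Unshelve. all: by end_near. Qed.

Lemma gt1_ltr_powR (a x y : R) : 1 < a -> x < y -> a `^ x < a `^ y.
Proof.
move=> a1 xy; have a0 : 0 < a by lra.
by rewrite /powR gt_eqF// ltr_expR ltr_pM2r// ln_gt0.
Qed.

Lemma norm_ln1D_le (x : R) : `|x| <= 2^-1 -> `|ln (1 + x)| <= 2 * `|x|.
Proof.
rewrite ler_norml => /andP[xl xu].
have x1 : 0 < 1 + x by lra.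
rewrite ler_norml; apply/andP; split; last first.
  have /le_ln1Dx : -1 < x by lra.
  have := ler_norm x; have := normr_ge0 x; lra.
(* The inequality ln (1 + y) <= y at y = - x / (1 + x) bounds - ln (1 + x), since 1 + y is the
   inverse of 1 + x. *)
have /le_ln1Dx : -1 < - (x / (1 + x)).
  by rewrite ltrN2 ltr_pdivrMr//; lra.
have -> : 1 + - (x / (1 + x)) = (1 + x)^-1 by field; rewrite gt_eqF.
rewrite lnV ?posrE// => H.
rewrite lerNl; apply: (le_trans H).
rewrite -mulNr ler_pdivrMr//.
have [x0|x0] := ler0P x; last by nra.
have : 0 <= - x * (1 + 2 * x) by apply: mulr_ge0; lra.
nra.
Qed.

(** The increments of L t = ln (q t) - gamma ln t from t to 2t are of order A t, and A itself decays
    geometrically along doublings, with ratio tending to 2^rho < 1. They are therefore summable, L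
    converges, and [lam] is the exponential of its limit. *)
Lemma second_order_power q A (gamma rho : R) : 0 < gamma -> rho < 0 ->
  (forall s t, 1 < s -> s <= t -> q s <= q t) ->
  A t @[t --> +oo] --> (0 : R) ->
  (forall om : R, 0 < om ->
    (A t)^-1 * (q (om * t) / q t - om `^ gamma) @[t --> +oo] -->
    om `^ gamma * ((om `^ rho - 1) / rho)) ->
  exists2 lam : R, 0 < lam & q t * t `^ (- gamma) @[t --> +oo] --> lam.
Proof.
move=> g0 r0 qmon A0 Hq.
pose H om : R := (om `^ rho - 1) / rho.
pose E om t := (om `^ gamma)^-1 * ((A t)^-1 * (q (om * t) / q t - om `^ gamma)).
have EH om : 0 < om -> E om t @[t --> +oo] --> H om.
  move=> om0; have n0 : om `^ gamma != 0 by rewrite gt_eqF// powR_gt0.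
  by rewrite -[H om](mulKf n0); apply: cvgMr; exact: Hq.
have AE om : 0 < om -> A t * E om t @[t --> +oo] --> (0 : R).
  by move=> om0; rewrite -(mul0r (H om)); apply: cvgM => //; exact: EH.
have p2 : (0 : R) < 2 `^ rho < 1.
  by rewrite powR_gt0// -[ltRHS](powRr0 2) gt1_ltr_powR//; lra.
have H2 : H 2 != 0.
  by rewrite mulf_neq0// ?invr_eq0 ?lt_eqF// subr_lt0; case/andP: p2.
(* An instance of the cocycle identity H (a b) = H a + a^rho H b. *)
have H4 : H 4 - H 2 = 2 `^ rho * H 2.
  rewrite /H (_ : 4 = 2 * 2) ?powRM//; last by ring.
  by field; rewrite lt_eqF.
(* As the inverse of 0 is 0, [A t = 0] would give [E 2 t = 0], while [E 2 t] tends to [H 2], which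
   is nonzero. *)
have An0 : \forall t \near +oo, A t != 0.
  apply: filterS (cvgr_neq0 _ (EH 2 (ltr0Sn _ _)) H2) => t; apply: contraNN.
  by move=> /eqP At; rewrite /E At invr0 mul0r mulr0.
have qE om : 0 < om -> \forall t \near +oo, q (om * t) / q t = om `^ gamma * (1 + A t * E om t).
  move=> om0; move: An0; apply: filterS => t At; rewrite /E.
  have n0 : om `^ gamma != 0 by rewrite gt_eqF// powR_gt0.
  by move: (q _ / q _) => z; field; rewrite At n0.
(* The quotient q (2t) / q t exceeds 1 eventually. If q t were 0 the quotient would be 0 by
   convention; if q t were negative, q would decrease from t to 2t. *)
have q0 : \forall t \near +oo, 0 < q t.
  have r2 : q (2 * t) / q t @[t --> +oo] --> 2 `^ gamma.
    have Hc : 2 `^ gamma * (1 + A t * E 2 t) @[t --> +oo] --> 2 `^ gamma * (1 + 0).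
      by apply: cvgMr; apply: cvgD; [exact: cvg_cst|exact: AE].
    rewrite addr0 mulr1 in Hc; apply: cvg_near_eq Hc.
    by have := qE 2 (ltr0Sn _ _); apply: filterS.
  have g1 : 1 < 2 `^ gamma :> R by rewrite -[ltLHS](powRr0 2) gt1_ltr_powR//; lra.
  near=> t.
  have t1 : 1 < t by near: t; apply: nbhs_pinfty_gt; exact: num_real.
  have qt : 1 < q (2 * t) / q t by near: t; exact: (cvgr_gt _ r2).
  have qm : q t <= q (2 * t) by apply: qmon => //; lra.
  rewrite ltNge; apply/negP; rewrite le_eqVlt => /orP[/eqP q0|q0].
    by move: qt; rewrite q0 invr0 mulr0; lra.
  by move: qt; rewrite ltr_ndivlMr// mul1r => /lt_le_trans /(_ qm); rewrite ltxx.
pose L t := ln (q t) - gamma * ln t.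
have LE om : 0 < om -> \forall t \near +oo, L (om * t) - L t = ln (1 + A t * E om t).
  move=> om0; near=> t.
  have t0 : 0 < t by near: t; apply: nbhs_pinfty_gt; exact: num_real.
  have qt : 0 < q t by near: t.
  have qot : 0 < q (om * t) by near: t; exact: (near_pinfty_scale om0 q0).
  have : q (om * t) / q t = om `^ gamma * (1 + A t * E om t).
    by near: t; exact: qE.
  move=> /(congr1 (@ln R)); rewrite ln_div ?posrE//.
  have pg := @powR_gt0 _ om gamma om0.
  have p1 : 0 < 1 + A t * E om t.
    rewrite (_ : 1 + _ = (q (om * t) / q t) / om `^ gamma); first by rewrite !divr_gt0.
    have : q (om * t) / q t = om `^ gamma * (1 + A t * E om t) by near: t; exact: qE.
    by move=> ->; field; rewrite gt_eqF.
  rewrite lnM ?posrE// ln_powR => Hl.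
  by rewrite /L lnM ?posrE//; rewrite -(addrK (gamma * ln om) (ln (1 + _))) [_ + gamma * ln om]addrC -Hl; ring.
have lncvg om : 0 < om -> L (om * t) - L t @[t --> +oo] --> (0 : R).
  move=> om0; apply: (@cvg_near_eq _ _ _ _ (fun t => ln (1 + A t * E om t))).
    by have := LE _ om0; apply: filterS => t ->.
  rewrite -(@ln1 R); apply: continuous_cvg; first exact: continuous_ln.
  by rewrite -[X in _ --> X](addr0 1); apply: cvgD; [exact: cvg_cst|exact: AE].
(* The expansion of q (4t) / q t is the product of those of q (4t) / q (2t) and q (2t) / q t.
   Comparing the terms in A expresses A (2t) / A t through values of [E], whose limits are known. *)
have Arat : A (2 * t) / A t @[t --> +oo] --> 2 `^ rho.
  have Hc : (E 4 t - E 2 t) * (E 2 (2 * t) * (1 + A t * E 2 t))^-1 @[t --> +oo] -->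
      2 `^ rho.
    rewrite -(mulfK H2 (2 `^ rho)) -H4; apply: cvgM; first by apply: cvgB; exact: EH.
    have -> : (H 2)^-1 = (H 2 * (1 + 0))^-1 by rewrite addr0 mulr1.
    apply: cvgV; first by rewrite addr0 mulr1.
    apply: cvgM; first by apply: (cvgy_scale (ltr0Sn _ _)); exact: EH.
    by apply: cvgD; [exact: cvg_cst|exact: AE].
  apply: cvg_near_eq Hc.
  near=> t.
  have At : A t != 0 by near: t.
  have A2t : A (2 * t) != 0 by near: t; exact: (near_pinfty_scale (ltr0Sn _ _) An0).
  have E2 : E 2 (2 * t) != 0.
    near: t; apply: (@near_pinfty_scale (fun t => E 2 t != 0) 2) => //.
    by apply: cvgr_neq0 (EH 2 (ltr0Sn _ _)) H2.
  have qt : q t != 0 by rewrite gt_eqF//; near: t.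
  have q2t : q (2 * t) != 0 by rewrite gt_eqF//; near: t; exact: (near_pinfty_scale (ltr0Sn _ _) q0).
  have q4t : q (4 * t) != 0 by rewrite gt_eqF//; near: t; exact: (near_pinfty_scale (ltr0Sn _ _) q0).
  have e1 : q (2 * t) / q t = 2 `^ gamma * (1 + A t * E 2 t) by near: t; exact: qE.
  have e2 : q (2 * (2 * t)) / q (2 * t) = 2 `^ gamma * (1 + A (2 * t) * E 2 (2 * t)).
    near: t; apply: (@near_pinfty_scale (fun t => q (2 * t) / q t = 2 `^ gamma * (1 + A t * E 2 t)) 2) => //.
    exact: qE.
  have e4 : q (4 * t) / q t = 4 `^ gamma * (1 + A t * E 4 t) by near: t; exact: qE.
  have g2 : 2 `^ gamma != 0 :> R by rewrite gt_eqF// powR_gt0.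
  have g4 : 4 `^ gamma = 2 `^ gamma * 2 `^ gamma :> R by rewrite -powRM// -natrM.
  have e1n : 1 + A t * E 2 t != 0.
    apply/eqP => e; move: e1; rewrite e mulr0 => /eqP.
    by rewrite mulf_eq0 invr_eq0 (negbTE qt) (negbTE q2t).
  have : (1 + A t * E 4 t) = (1 + A (2 * t) * E 2 (2 * t)) * (1 + A t * E 2 t).
    apply: (mulfI (mulf_neq0 g2 g2)); rewrite -{1}g4 -e4 mulrACA -e1 -e2.
    by rewrite mulrA -natrM; field; rewrite qt q2t.
  move=> e; have {}e : A t * (E 4 t - E 2 t) = A (2 * t) * (E 2 (2 * t) * (1 + A t * E 2 t)).
    by move: e; lra.
  apply: (mulfI At); rewrite [LHS]mulrA e mulfK; last exact: mulf_neq0.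
  by rewrite mulrCA divff// mulr1.
(* The midpoint between 2^rho and 1. *)
pose theta : R := (1 + 2 `^ rho) / 2.
have th : 0 <= theta < 1 by rewrite /theta; lra.
(* The factor 2 is that of [norm_ln1D_le]; |H 2| + 1 eventually bounds |E 2 t|. *)
pose B := 2 * (`|H 2| + 1).
have B0 : 0 <= B by rewrite /B mulr_ge0// addr_ge0.
have /near_pinftyP[T HT] : \forall t \near +oo, [/\ 0 < t, A t != 0,
    `|A (2 * t) / A t| < theta & `|L (2 * t) - L t| <= B * `|A t|].
  near=> w.
  have Aw : A w != 0 by near: w.
  split; [|exact: Aw|..].
  - by near: w; apply: nbhs_pinfty_gt; exact: num_real.
  - near: w; have /cvg_norm := Arat.
    rewrite ger0_norm ?powR_ge0// => Hn; apply: cvgr_lt Hn _ _.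
    by rewrite /theta; lra.
  - have -> : L (2 * w) - L w = ln (1 + A w * E 2 w) by near: w; exact: LE.
    have hA : `|A w * E 2 w| < 2^-1.
      near: w; have /cvg_norm := AE 2 (ltr0Sn _ _); rewrite normr0 => Hn.
      by apply: cvgr_lt Hn _ _; lra.
    have hE : `|E 2 w| < `|H 2| + 1.
      by near: w; have /cvg_norm := EH 2 (ltr0Sn _ _) => Hn; apply: cvgr_lt Hn _ _; lra.
    apply: (le_trans (norm_ln1D_le (ltW hA))).
    by rewrite normrM /B -mulrA ler_wpM2l// mulrC ler_wpM2r// ltW.
have T0 : 0 < T by have [] := HT T (lexx T).
have [l Ll] : exists l : R, L t @[t --> +oo] --> l.
  apply: (@cvg_dyadic L (fun t => B * `|A t|) theta T T0 th).
  - move=> t /HT[t0 At + _]; rewrite normrM normfV => Ht.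
    by rewrite mulrCA ler_wpM2l// -ler_pdivrMr ?normr_gt0// ltW.
  - by move=> t /HT[].
  - exact: lncvg.
  - by rewrite -(mulr0 B); apply: cvgMr; rewrite -(normr0 R); apply: cvg_norm.
exists (expR l); first exact: expR_gt0.
have : expR (L t) @[t --> +oo] --> expR l.
  by apply: continuous_cvg => //; exact: continuous_expR.
apply: cvg_near_eq; near=> z.
have z0 : 0 < z by near: z; apply: nbhs_pinfty_gt; exact: num_real.
have qz : 0 < q z by near: z.
rewrite /L expRD lnK ?posrE// -mulNr; congr (_ * _).
by rewrite /powR gt_eqF.
Unshelve. all: by end_near. Qed.

End second_order_condition.

(** * From the quantile function to the tail *)

Section quantile_tail.
Variable R : realType.
Implicit Types F : R -> R.

Lemma powRV (a x : R) : 0 < a -> a^-1 `^ x = (a `^ x)^-1.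
Proof.
move=> a0; have ax : a `^ x != 0 by rewrite gt_eqF// powR_gt0.
apply: (mulIf ax); rewrite mulVf// -powRM ?invr_ge0 ?ltW//.
by rewrite mulVf ?gt_eqF// powR1.
Qed.

Lemma near_pinfty_powR (Q : R -> Prop) (a : R) : 0 < a ->
  (\forall t \near +oo, Q t) -> \forall t \near +oo, Q (t `^ a).
Proof.
move=> a0 /near_pinftyP[T TQ]; apply/near_pinftyP.
exists (Num.max 0 T `^ a^-1) => t Tt; apply: TQ.
have m0 : 0 <= Num.max 0 T by rewrite le_max lexx.
have : (Num.max 0 T `^ a^-1) `^ a <= t `^ a.
  apply: ge0_ler_powR => //; rewrite ?(ltW a0)// nnegrE ?powR_ge0//.
  exact: le_trans (powR_ge0 _ _) Tt.
rewrite -powRrM mulVf ?gt_eqF// powRr1//; apply: le_trans.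
by rewrite le_max lexx orbT.
Qed.

Variable F : R -> R.
Hypotheses (Fmon : {homo F : s t / s <= t}) (F0 : F t @[t --> -oo] --> (0 : R))
  (F1 : F t @[t --> +oo] --> (1 : R)).

Let quantile_has_inf p : 0 < p < 1 -> has_inf [set t | p <= F t].
Proof.
move=> /andP[p0 p1]; split.
  have /near_pinftyP[T HT] : \forall t \near +oo, p < F t by apply: cvgr_gt F1 _ p1.
  by exists T => /=; rewrite ltW// HT.
have [M [_ HM]] : \forall t \near -oo, F t < p by apply: cvgr_lt F0 _ p0.
exists (M - 1) => t /= pt; rewrite leNgt; apply/negP => tM.
have /HM : t < M by lra.
by rewrite ltNge pt.
Qed.

Lemma quantile_homo p p' : 0 < p -> p <= p' -> p' < 1 ->
  quantile F p <= quantile F p'.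
Proof.
move=> p0 pp' p'1; have hp : 0 < p < 1 by rewrite p0 (le_lt_trans pp').
have hp' : 0 < p' < 1 by rewrite p'1 (lt_le_trans p0).
apply: lb_le_inf; first by have [] := quantile_has_inf hp'.
move=> t /= Ht; apply: ge_inf; first by have [] := quantile_has_inf hp.
exact: le_trans Ht.
Qed.

Lemma lt_quantile p t : 0 < p < 1 -> t < quantile F p -> F t < p.
Proof.
move=> hp tq; rewrite ltNge; apply/negP => pt.
have : quantile F p <= t by apply: ge_inf => //; have [] := quantile_has_inf hp.
by rewrite leNgt tq.
Qed.

Lemma gt_quantile p t : 0 < p < 1 -> quantile F p < t -> p <= F t.
Proof.
move=> hp qt; have [ne _] := quantile_has_inf hp.
by have [u /= pu ut] := inf_lt ne qt; exact: le_trans pu (Fmon (ltW ut)).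
Qed.

(** For K above the limit and s = t^(1/gamma) / K, the quantile at 1 - 1/s is eventually below
    K^gamma s^gamma = t, so F t >= 1 - 1/s, which says that (1 - F t) t^(1/gamma) <= K. For K below
    the limit the inequalities reverse. The two order relations between [F] and its quantile
    function suffice. *)
Lemma quantile_power_tail (gamma lam : R) : 0 < gamma -> 0 < lam ->
  quantile F (1 - t^-1) * t `^ (- gamma) @[t --> +oo] --> lam ->
  (1 - F t) * t `^ gamma^-1 @[t --> +oo] --> lam `^ gamma^-1.
Proof.
move=> g0 l0 Hq.
have gV0 : 0 < gamma^-1 by rewrite invr_gt0.
have la0 : 0 < lam `^ gamma^-1 by rewrite powR_gt0.
have lamE : lam = (lam `^ gamma^-1) `^ gamma.
  by rewrite -powRrM mulVf ?gt_eqF// powRr1 ?ltW.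
have nearK K (Q : R -> Prop) : 0 < K -> (\forall s \near +oo, Q s) ->
    \forall t \near +oo, Q (K^-1 * t `^ gamma^-1).
  move=> K0 nQ; apply: (@near_pinfty_powR (fun u => Q (K^-1 * u)) _ gV0).
  by apply: near_pinfty_scale => //; rewrite invr_gt0.
have sE K t : 0 < K -> 0 < t -> (K^-1 * t `^ gamma^-1) `^ gamma = t / K `^ gamma.
  move=> K0 t0; rewrite powRM ?invr_ge0 ?powR_ge0 ?ltW//.
  rewrite -powRrM mulVf ?gt_eqF// powRr1 ?ltW// mulrC; congr (_ * _).
  exact: powRV.
have invE K t : 0 < K -> 0 < t -> (K^-1 * t `^ gamma^-1)^-1 * t `^ gamma^-1 = K.
  move=> K0 t0; have tg := powR_gt0 gamma^-1 t0.
  by field; rewrite !gt_eqF.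
have ps (s : R) : 1 < s -> 0 < 1 - s^-1 < 1.
  move=> s1; have : s^-1 < 1 by rewrite invf_lt1 ?(lt_trans ltr01).
  have : 0 < s^-1 by rewrite invr_gt0 (lt_trans ltr01).
  lra.
have upper K : lam `^ gamma^-1 < K ->
    \forall t \near +oo, (1 - F t) * t `^ gamma^-1 <= K.
  move=> lK; have K0 := lt_trans la0 lK.
  have lKg : lam < K `^ gamma by rewrite [ltLHS]lamE gt0_ltr_powR// nnegrE ltW.
  near=> t.
  have t0 : 0 < t by near: t; apply: nbhs_pinfty_gt; exact: num_real.
  have s1 : 1 < K^-1 * t `^ gamma^-1.
    near: t; apply: (nearK K (fun s => 1 < s)) => //.
    by apply: nbhs_pinfty_gt; exact: num_real.
  have : quantile F (1 - (K^-1 * t `^ gamma^-1)^-1) * (K^-1 * t `^ gamma^-1) `^ (- gamma) < K `^ gamma.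
    near: t; apply: (nearK K (fun s => quantile F (1 - s^-1) * s `^ (- gamma) < K `^ gamma)) => //.
    by apply: cvgr_lt Hq _ lKg.
  move: (invE K t K0 t0) (sE K t K0 t0) s1.
  move: (K^-1 * _) => s sK sg s1.
  have s0 : 0 < s by lra.
  rewrite powRN ltr_pdivrMr ?powR_gt0// sg mulrC divfK ?gt_eqF ?powR_gt0// => qs.
  rewrite -[leRHS]sK ler_wpM2r ?powR_ge0//.
  suff : 1 - s^-1 <= F t by lra.
  exact: gt_quantile (ps _ s1) qs.
have lower K : 0 < K -> K < lam `^ gamma^-1 ->
    \forall t \near +oo, K <= (1 - F t) * t `^ gamma^-1.
  move=> K0 lK.
  have lKg : K `^ gamma < lam by rewrite [ltRHS]lamE gt0_ltr_powR// nnegrE ltW.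
  near=> t.
  have t0 : 0 < t by near: t; apply: nbhs_pinfty_gt; exact: num_real.
  have s1 : 1 < K^-1 * t `^ gamma^-1.
    near: t; apply: (nearK K (fun s => 1 < s)) => //.
    by apply: nbhs_pinfty_gt; exact: num_real.
  have : K `^ gamma < quantile F (1 - (K^-1 * t `^ gamma^-1)^-1) * (K^-1 * t `^ gamma^-1) `^ (- gamma).
    near: t; apply: (nearK K (fun s => K `^ gamma < quantile F (1 - s^-1) * s `^ (- gamma))) => //.
    by apply: cvgr_gt Hq _ lKg.
  move: (invE K t K0 t0) (sE K t K0 t0) s1.
  move: (K^-1 * _) => s sK sg s1.
  have s0 : 0 < s by lra.
  rewrite powRN ltr_pdivlMr ?powR_gt0// sg mulrC divfK ?gt_eqF ?powR_gt0// => qs.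
  rewrite -[leLHS]sK ler_wpM2r ?powR_ge0//.
  suff : F t < 1 - s^-1 by lra.
  exact: lt_quantile (ps _ s1) qs.
apply/cvgrPdist_le => e e0.
near=> t; rewrite ler_norml; apply/andP; split.
  suff : (1 - F t) * t `^ gamma^-1 <= lam `^ gamma^-1 + e by lra.
  by near: t; apply: upper; lra.
(* [lower] asks for a positive constant, and the limit minus [e] may be negative. *)
pose K := Num.max (lam `^ gamma^-1 / 2) (lam `^ gamma^-1 - e).
suff : K <= (1 - F t) * t `^ gamma^-1.
  by rewrite /K ge_max => /andP[_]; lra.
near: t; apply: lower; first by rewrite lt_max; apply/orP; left; lra.
by rewrite gt_max; apply/andP; split; lra.
Unshelve. all: by end_near. Qed.

End quantile_tail.

(** * Squeezing and the monotone density theorem *)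

Section squeeze.
Variable R : realType.

Lemma squeeze_scaled_cvg (f : R -> R) (C k : R) : 0 < k -> 0 < C ->
  (forall C1, C < C1 -> \forall t \near +oo, f t <= C1 * k) ->
  (forall C1, 0 < C1 -> C1 < C -> \forall t \near +oo, C1 * k <= f t) ->
  f t @[t --> +oo] --> C * k.
Proof.
move=> k0 C0 up lo; apply/cvgrPdist_le => e e0.
have ek : 0 < e / k by rewrite divr_gt0.
near=> u; rewrite ler_norml; apply/andP; split.
  suff : f u <= (C + e / k) * k by rewrite mulrDl divfK ?gt_eqF//; lra.
  by near: u; apply: up; lra.
suff : Num.max (C / 2) (C - e / k) * k <= f u.
  rewrite maxr_pMl ?(ltW k0)// ge_max => /andP[_].
  by rewrite mulrBl divfK ?gt_eqF//; lra.
near: u; apply: lo; first by rewrite lt_max divr_gt0.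
by rewrite gt_max; apply/andP; split; lra.
Unshelve. all: by end_near. Qed.

Lemma norm_sandwich (x k1 k2 q1 q2 q3 e : R) :
  `|x - k1| < e / 2 -> `|x - k2| < e / 2 ->
  `|k1 - q1| < e / 2 -> `|k2 - q2| < e / 2 -> q1 <= q3 -> q3 <= q2 ->
  `|x - q3| <= e.
Proof.
rewrite !ltr_norml => /andP[? ?] /andP[? ?] /andP[? ?] /andP[? ?] ? ?.
by rewrite ler_norml; apply/andP; split; lra.
Qed.

End squeeze.

Section monotone_density.
Variable R : realType.

(* Karamata's argument: h u lies between the slopes of F over [u, (1 + d) u]
   and over [(1 - d) u, u], which are explicit as u -> oo; then d -> 0. *)
Lemma monotone_density (F h : R -> R) (K b T : R) :
  (forall u v, T < u -> u <= v -> (v - u) * h v <= F u - F v <= (v - u) * h u) ->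
  F u * u `^ b @[u --> +oo] --> K ->
  h u * u `^ (b + 1) @[u --> +oo] --> K * b.
Proof.
move=> Fh FK.
(* One formula for both slopes: they lie to the right of [u] for d > 0 and to the left for d < 0.
   The factor u of the denominator is absorbed in the normalization by u^(b + 1). *)
pose Q d u := (F u - F ((1 + d) * u)) / d * u `^ b.
have Qc d : - 1 < d -> Q d u @[u --> +oo] --> K * ((1 - (1 + d) `^ (- b)) / d).
  move=> d1; have d0 : 0 < 1 + d by lra.
  have := cvgy_scale d0 FK => Fd.
  have -> : K * ((1 - (1 + d) `^ (- b)) / d) = (K - K * (1 + d) `^ (- b)) / d.
    by ring.
  apply: (@cvg_near_eq _ _ _ _ (fun u => (F u * u `^ b -
    F ((1 + d) * u) * ((1 + d) * u) `^ b * (1 + d) `^ (- b)) / d)); last first.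
    by apply: cvgMl; apply: cvgB => //; apply: cvgMl.
  near=> u.
  have u0 : 0 < u by near: u; apply: nbhs_pinfty_gt; exact: num_real.
  rewrite powRM ?ltW// powRN /Q.
  move: (powR_gt0 b d0) => p0.
  rewrite -[_ * (_ * _) * _]mulrA [_ * _ / _ in X in _ - X]mulrAC divff ?gt_eqF// mul1r.
  by ring.
(* Up to sign, the difference quotient at 1 of y^(-b), whose derivative there is -b. *)
have lim_slope : K * ((1 - (1 + d) `^ (- b)) / d) @[d --> 0^'] --> K * b.
  apply: cvgMr.
  have [dP dE] := @is_derive1_powR R (- b) 1 ltr01.
  have Hd : d^-1 *: (((@powR R)^~ (- b) \o shift 1) (d *: 1) - 1 `^ (- b))
      @[d --> 0^'] --> 'D_1 ((@powR R)^~ (- b)) 1 by exact: dP.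
  rewrite dE powR1 mulr1 in Hd.
  rewrite -[X in _ --> X]opprK; apply: cvg_near_eq (cvgN Hd).
  near=> d; change (- (d^-1 * ((d * 1 + 1) `^ (- b) - 1)) = (1 - (1 + d) `^ (- b)) / d).
  by rewrite mulr1 (addrC d); ring.
apply/cvgrPdist_le => e e0.
have e2 : 0 < e / 2 by rewrite divr_gt0.
have [d [d0 d1 dp dm]] : exists d, [/\ 0 < d, d < 1,
    `|K * b - K * ((1 - (1 + d) `^ (- b)) / d)| < e / 2 &
    `|K * b - K * ((1 - (1 + - d) `^ (- b)) / - d)| < e / 2].
  have := lim_slope; move=> /cvgrPdist_lt /(_ _ e2) [r /= r0 rP].
  have m0 : 0 < Num.min (r / 2) 2^-1 by rewrite lt_min; apply/andP; split; lra.
  have mr : Num.min (r / 2) 2^-1 <= r / 2 by rewrite ge_min lexx.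
  have m2 : Num.min (r / 2) 2^-1 <= 2^-1 by rewrite ge_min lexx orbT.
  move: (Num.min _ _) m0 mr m2 => d d0 dr d2.
  exists d; split => //; first by lra.
  - apply: rP; last by rewrite gt_eqF.
    by rewrite /ball_/= sub0r normrN gtr0_norm//; lra.
  - apply: rP; last by rewrite oppr_eq0 gt_eqF.
    by rewrite /ball_/= sub0r opprK gtr0_norm//; lra.
have dn1 : -1 < d by lra.
have dnm1 : -1 < - d by lra.
have /cvgrPdist_lt /(_ _ e2) Np := Qc d dn1.
have /cvgrPdist_lt /(_ _ e2) Nm := Qc (- d) dnm1.
near=> u.
have u0 : 0 < u by near: u; apply: nbhs_pinfty_gt; exact: num_real.
have uT : T < (1 - d) * u.
  near: u; apply: (@near_pinfty_scale _ (fun v => T < v)); first by lra.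
  by apply: nbhs_pinfty_gt; exact: num_real.
have Tu : T < u by apply: lt_le_trans uT _; nra.
have uu1 : u <= (1 + d) * u by nra.
have u1u : (1 - d) * u <= u by nra.
have ub0 := powR_gt0 b u0.
have hE : h u * u `^ (b + 1) = u * h u * u `^ b.
  by rewrite powRD ?(gt_eqF u0) ?implybT// powRr1 ?ltW//; ring.
have lo : Q d u <= h u * u `^ (b + 1).
  rewrite hE /Q (ler_wpM2r (ltW ub0))// ler_pdivrMr//.
  have /andP[_] := Fh u ((1 + d) * u) Tu uu1; lra.
have hi : h u * u `^ (b + 1) <= Q (- d) u.
  rewrite hE /Q (ler_wpM2r (ltW ub0))// invrN mulrN -mulNr opprB ler_pdivlMr//.
  have /andP[+ _] := Fh ((1 + - d) * u) u uT u1u; lra.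
have Hp : `|K * ((1 - (1 + d) `^ (- b)) / d) - Q d u| < e / 2 by near: u.
have Hm : `|K * ((1 - (1 + - d) `^ (- b)) / - d) - Q (- d) u| < e / 2 by near: u.
exact: norm_sandwich dp dm Hp Hm lo hi.
Unshelve. all: by end_near. Qed.

End monotone_density.

(** * Laplace moments *)

Section lebesgue_scaling.
Variable R : realType.
Local Notation mu := (@lebesgue_measure R).
Local Open Scope ereal_scope.

(** The image of k times Lebesgue measure under multiplication by k agrees with Lebesgue measure on
    half-open intervals, hence everywhere. *)
Lemma ge0_integral_lebesgue_scale (k : R) (f : R -> \bar R) : (0 < k)%R ->
  measurable_fun [set: R] f -> (forall x, 0 <= f x) ->
  \int[mu]_x f x = k%:E * \int[mu]_x f (k * x)%R.
Proof.
move=> k0 mf f0.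
pose phi (x : measurableTypeR R) : measurableTypeR R := (k * x)%R.
have mphi : measurable_fun setT phi by exact: mulrl_measurable.
pose push : {measure set (measurableTypeR R) -> \bar R} :=
  mscale (NngNum (ltW k0)) (pushforward mu phi).
pose m := push mphi.
transitivity (\int[m]_x f x).
  apply: eq_measure_integral => /= A mA _.
  apply: lebesgue_measure_unique => //= _ [[a b]] _ <-.
  rewrite /= /mscale/= /pushforward/=.
  have -> : phi @^-1` [set` `]a, b]%R] = [set` `](a / k)%R, (b / k)%R]%R].
    apply/seteqP; split => x /=; rewrite !in_itv/= /phi.
      by rewrite ltr_pdivrMr// ler_pdivlMr// mulrC.
    by rewrite ltr_pdivrMr// ler_pdivlMr// mulrC.
  rewrite !lebesgue_measure_itv/= !lte_fin ltr_pM2r ?invr_gt0//.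
  case: ifPn => _; last by rewrite mule0.
  by rewrite -!EFinD -EFinM; congr EFin; field; rewrite gt_eqF.
rewrite /m ge0_integral_mscale//=; congr (_ * _).
by rewrite (@ge0_integral_pushforward _ _ _ _ _ phi).
Qed.

End lebesgue_scaling.

Section laplace_moment.
Variable R : realType.
Local Notation leb := (@lebesgue_measure R).

(* Vanishes for y <= 0, so that powers of y need no sign condition. *)
Definition gamma_kernel (a u y : R) : R :=
  ((0 < y)%R)%:R * (y `^ a * expR (- (u * y))).

Lemma gamma_kernel_ge0 a u y : 0 <= gamma_kernel a u y.
Proof. by rewrite !mulr_ge0 ?powR_ge0 ?expR_ge0. Qed.

Lemma measurable_gamma_kernel d (T : measurableType d) (a : R) (u f : T -> R) :
  measurable_fun setT u -> measurable_fun setT f ->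
  measurable_fun setT (fun t => gamma_kernel a (u t) (f t)).
Proof.
move=> mu mf; apply: measurable_funM.
  rewrite (_ : (fun _ => _) = (fun t => \1_`]0, +oo[%classic (f t))); last first.
    by apply/funext => t; rewrite indicE mem_setE/= in_itv/= andbT.
  by apply: measurableT_comp mf; exact: measurable_indic.
apply: measurable_funM; first exact: measurableT_comp (measurable_powR a) mf.
apply: measurableT_comp => //; apply: measurableT_comp => //.
exact: measurable_funM.
Qed.

Context d (T : measurableType d).

Definition laplace_moment (m : set T -> \bar R) (f : T -> R) (a u : R) : \bar R :=
  (\int[m]_w (gamma_kernel a u (f w))%:E)%E.

(** Kept in the extended reals: the change of variables holds before finiteness is known, whereas
    [Gamma] would turn an infinite integral into 0. *)
Definition Egamma (c : R) : \bar R := (\int[leb]_s (gamma_kernel (c - 1) 1 s)%:E)%E.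

Lemma GammaE c : Gamma c = fine (Egamma c).
Proof.
rewrite /Gamma /Rintegral /Egamma [in LHS]integral_mkcond; congr fine.
apply: eq_integral => y _; rewrite patchE mem_setE in_itv/= andbT /gamma_kernel.
by case: ifP => y0; rewrite ?mul1r// mul0r.
Qed.

Lemma integral_gamma_kernel c y : 0 < y ->
  (\int[leb]_s (gamma_kernel (c - 1) y s)%:E = Egamma c * (y `^ (- c))%:E)%E.
Proof.
move=> y0; rewrite /Egamma (@ge0_integral_lebesgue_scale _ y (fun s => (gamma_kernel (c - 1) 1 s)%:E)) //; last 2 first.
- apply/measurable_EFinP; exact: measurable_gamma_kernel.
- by move=> x; rewrite lee_fin gamma_kernel_ge0.
have -> : (\int[leb]_x (gamma_kernel (c - 1) 1 (y * x))%:E =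
    \int[leb]_x ((y `^ (c - 1))%:E * (gamma_kernel (c - 1) y x)%:E))%E.
  apply: eq_integral => x _; rewrite -EFinM; congr EFin.
  rewrite /gamma_kernel pmulr_rgt0// mul1r; case: ltP => x0; last by rewrite !mul0r mulr0.
  by rewrite !mul1r powRM ?ltW// mulrA.
rewrite ge0_integralZl_EFin//; last 3 first.
- by move=> x _; rewrite lee_fin gamma_kernel_ge0.
- apply/measurable_EFinP; exact: measurable_gamma_kernel.
- exact: powR_ge0.
rewrite muleA [RHS]muleAC -!EFinM.
suff -> : y * y `^ (c - 1) * y `^ (- c) = 1 by rewrite mul1e.
rewrite -{1}(powRr1 (ltW y0)) -!powRD ?(gt_eqF y0) ?implybT//.
by rewrite (_ : 1 + (c - 1) + - c = 0) ?powRr0//; ring.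
Qed.
End laplace_moment.

Section laplace_moment_theory.
Variable R : realType.
Local Notation leb := (@lebesgue_measure R).
Context d (T : measurableType d).

Lemma laplace_moment_ge0 (m : {measure set T -> \bar R}) f a u :
  (0 <= laplace_moment m f a u)%E.
Proof. by apply: integral_ge0 => w _; rewrite lee_fin gamma_kernel_ge0. Qed.

(** With second argument 0 the kernel is s^(c-1) on s > 0. By Tonelli the integral over s acts on
    each value y of [f] separately, and that of s^(c-1) exp(-s y) is Gamma c times y^(-c): the
    exponent drops from a + c to a. *)
Lemma laplace_moment_abel (m : {sigma_finite_measure set T -> \bar R})
    (f : T -> R) (a c u : R) :
  measurable_fun setT f -> Egamma c \is a fin_num ->
  (\int[leb]_s ((gamma_kernel (c - 1) 0 s)%:E *
     laplace_moment m f (a + c) (u + s)) =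
   (Gamma c)%:E * laplace_moment m f a u)%E.
Proof.
move=> mf cfin; rewrite GammaE fineK//.
have mk1 : measurable_fun setT (fun s : measurableTypeR R => gamma_kernel (c - 1) 0 s).
  exact: measurable_gamma_kernel.
have mk2 : measurable_fun setT (fun p : measurableTypeR R * T =>
    gamma_kernel (a + c) (u + p.1) (f p.2)).
  apply: measurable_gamma_kernel; last exact: measurableT_comp.
  exact: measurable_funD.
pose F (p : measurableTypeR R * T) : \bar R :=
  (gamma_kernel (c - 1) 0 p.1 * gamma_kernel (a + c) (u + p.1) (f p.2))%:E.
have mF : measurable_fun setT F.
  apply/measurable_EFinP; apply: measurable_funM => //.
  exact: (measurableT_comp mk1).
have F0 p : (0 <= F p)%E by rewrite lee_fin mulr_ge0 ?gamma_kernel_ge0.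
transitivity (\int[leb]_s \int[m]_w F (s, w))%E.
  apply: eq_integral => s _; rewrite /F/= /laplace_moment.
  rewrite -ge0_integralZl_EFin ?gamma_kernel_ge0//.
  - by move=> w _; rewrite lee_fin gamma_kernel_ge0.
  - apply/measurable_EFinP; exact: measurable_gamma_kernel.
rewrite fubini_tonelli//.
have mk a' u' : measurable_fun setT (fun w => (gamma_kernel a' u' (f w))%:E).
  by apply/measurable_EFinP; exact: measurable_gamma_kernel.
have e0 : (0 <= Egamma c)%E.
  by apply: integral_ge0 => s _; rewrite lee_fin gamma_kernel_ge0.
rewrite /laplace_moment -{1}(fineK cfin) -ge0_integralZl_EFin ?fine_ge0//; last first.
  by move=> w _; rewrite lee_fin gamma_kernel_ge0.
apply: eq_integral => w _; rewrite /F/= fineK//.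
move: (f w) => y; have [y0|y0] := ltP 0 y; last first.
  rewrite /gamma_kernel ltNge y0/= !mul0r mule0.
  by apply: integral0_eq => s _; rewrite [X in _ * X]mul0r mulr0.
transitivity (\int[leb]_s ((y `^ (a + c) * expR (- (u * y)))%:E *
    (gamma_kernel (c - 1) y s)%:E))%E.
  apply: eq_integral => s _; rewrite -EFinM; congr EFin.
  rewrite /gamma_kernel y0 !mul1r mul0r oppr0 expR0 mulr1.
  have [s0|s0] := ltP 0 s; last by rewrite !mul0r mulr0.
  by rewrite !mul1r mulrDl opprD expRD (mulrC y s); ring.
rewrite ge0_integralZl_EFin ?mulr_ge0 ?powR_ge0 ?expR_ge0//; last 2 first.
- by move=> s _; rewrite lee_fin gamma_kernel_ge0.
- by apply/measurable_EFinP; exact: measurable_gamma_kernel.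
rewrite integral_gamma_kernel// muleCA -EFinM; congr (_ * _)%E; congr EFin.
rewrite /gamma_kernel y0 mul1r mulrAC -powRD ?(gt_eqF y0) ?implybT//.
by rewrite addrK.
Qed.

(** Convexity of the exponential: exp(-u y) - exp(-v y) lies between (v - u) y exp(-v y) and (v - u)
    y exp(-u y), both bounds being instances of 1 + x <= exp x. Sums replace differences, since the
    moments may be infinite. *)
Lemma laplace_moment_increment (m : {measure set T -> \bar R}) (f : T -> R)
    (a u v : R) : measurable_fun setT f -> u <= v ->
  ((v - u)%:E * laplace_moment m f (a + 1) v + laplace_moment m f a v <=
     laplace_moment m f a u)%E /\
  (laplace_moment m f a u <=
     (v - u)%:E * laplace_moment m f (a + 1) u + laplace_moment m f a v)%E.
Proof.
move=> mf uv; rewrite -subr_ge0 in uv.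
have mk a' u' : measurable_fun setT (fun w => (gamma_kernel a' u' (f w))%:E).
  by apply/measurable_EFinP; exact: measurable_gamma_kernel.
have k0 a' u' w : setT w -> (0 <= (gamma_kernel a' u' (f w))%:E)%E.
  by rewrite lee_fin gamma_kernel_ge0.
have comb u' : ((v - u)%:E * laplace_moment m f (a + 1) u' + laplace_moment m f a v =
   \int[m]_w ((v - u) * gamma_kernel (a + 1) u' (f w) + gamma_kernel a v (f w))%:E)%E.
  rewrite /laplace_moment -ge0_integralZl_EFin//; last by move=> w; exact: k0.
  rewrite -ge0_integralD//; last by move=> w; exact: k0.
  - by move=> w _; rewrite lee_fin mulr_ge0 ?gamma_kernel_ge0.
  - by apply: measurable_funeM.
have mc u' : measurable_fun setT (fun w =>
    ((v - u) * gamma_kernel (a + 1) u' (f w) + gamma_kernel a v (f w))%:E).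
  apply/measurable_EFinP; apply: measurable_funD; last exact: measurable_gamma_kernel.
  by apply: measurable_funM => //; exact: measurable_gamma_kernel.
rewrite !comb; split; apply: ge0_le_integral => //.
- by move=> w _; rewrite lee_fin; apply: addr_ge0; [apply: mulr_ge0|];
    rewrite ?gamma_kernel_ge0.
- move=> w _; rewrite lee_fin; move: (f w) => y.
  rewrite /gamma_kernel; case: ltP => y0; last by rewrite !mul0r mulr0 addr0.
  rewrite !mul1r powRD ?(gt_eqF y0) ?implybT// (powRr1 (ltW y0)).
  have -> : (v - u) * (y `^ a * y * expR (- (v * y))) + y `^ a * expR (- (v * y)) =
    y `^ a * (expR (- (v * y)) * (1 + (v - u) * y)) by ring.
  rewrite ler_wpM2l ?powR_ge0//.
  have -> : - (u * y) = - (v * y) + (v - u) * y by ring.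
  by rewrite expRD ler_wpM2l ?expR_ge0// expR_ge1Dx.
- by move=> w; exact: k0.
- move=> w _; rewrite lee_fin; move: (f w) => y.
  rewrite /gamma_kernel; case: ltP => y0; last by rewrite !mul0r mulr0 addr0.
  rewrite !mul1r powRD ?(gt_eqF y0) ?implybT// (powRr1 (ltW y0)).
  have -> : - (v * y) = - (u * y) + - ((v - u) * y) by ring.
  rewrite expRD.
  have -> : (v - u) * (y `^ a * y * expR (- (u * y))) + y `^ a * (expR (- (u * y)) * expR (- ((v - u) * y))) =
    y `^ a * (expR (- (u * y)) * ((v - u) * y + expR (- ((v - u) * y)))) by ring.
  rewrite ler_wpM2l ?powR_ge0// ler_peMr ?expR_ge0//.
  by have := expR_ge1Dx (- ((v - u) * y)); lra.
Qed.

(** From x <= exp x at x = (u - v) y / a. The case v = 0 bounds the kernel, which makes moments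
    finite under a probability; the case v = 1/2 leaves an integrable exponential. *)
Lemma gamma_kernel_le (a u v y : R) : 0 < a -> v < u ->
  gamma_kernel a u y <= (a / (u - v)) `^ a * expR (- (v * y)).
Proof.
move=> a0 vu; rewrite -subr_gt0 in vu.
rewrite /gamma_kernel; case: ltP => y0; last by rewrite mul0r mulr_ge0 ?powR_ge0 ?expR_ge0.
have k0 : 0 < a / (u - v) by rewrite divr_gt0.
rewrite mul1r.
have -> : - (v * y) = (u - v) * y + - (u * y) by ring.
rewrite expRD mulrA ler_wpM2r ?expR_ge0//.
have -> : expR ((u - v) * y) = expR ((u - v) * y / a) `^ a.
  by rewrite -expRM divfK// gt_eqF.
rewrite -powRM ?expR_ge0 ?(ltW k0)//.
apply: ge0_ler_powR; rewrite ?nnegrE ?(ltW y0) ?(ltW a0) ?(mulr_ge0 (ltW k0) (expR_ge0 _))//.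
have : (u - v) * y / a <= expR ((u - v) * y / a).
  by apply: le_trans (expR_ge1Dx _); rewrite lerDr.
move=> /(ler_wpM2l (ltW k0)); apply: le_trans.
by rewrite le_eqVlt; apply/orP; left; apply/eqP; field; rewrite !gt_eqF.
Qed.

End laplace_moment_theory.

(** * Integrals of powers and finiteness of Gamma *)

Section power_integrals.
Variable R : realType.
Local Notation leb := (@lebesgue_measure R).

Lemma continuous_powR_gt0 (a x : R) : 0 < x -> {for x, continuous (@powR R ^~ a)}.
Proof.
move=> x0; apply: differentiable_continuous; apply/derivable1_diffP.
by have [] := is_derive1_powR a x0.
Qed.

Lemma is_derive1_power_primitive (c x : R) : c != 0 -> 0 < x ->
  is_derive x 1 (fun y => c^-1 * y `^ c) (x `^ (c - 1)).
Proof.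
move=> c0 x0; have H := is_derive1_powR c x0.
have := @is_deriveZ _ _ _ (@powR R ^~ c) c^-1 x 1 _ H.
by rewrite /GRing.scale/= mulKf.
Qed.

Lemma within_continuous_powR (a : R) (A : set R) : A `<=` [set x | 0 < x] ->
  {within A, continuous (@powR R ^~ a)}.
Proof.
move=> A0; apply: continuous_in_subspaceT => x /[!inE] /A0.
exact: continuous_powR_gt0.
Qed.

Lemma integral_powR_near0 (c a : R) : 0 < c -> 0 < a < 1 ->
  (\int[leb]_(x in `[a, 1%R]) (x `^ (c - 1))%:E)%E = (c^-1 * (1 - a `^ c))%:E.
Proof.
move=> c0 /andP[a0 a1]; have cn0 : c != 0 by rewrite gt_eqF.
rewrite (@continuous_FTC2 _ _ (fun y => c^-1 * y `^ c))//.
- by rewrite -EFinB; congr EFin; rewrite powR1; ring.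
- apply: within_continuous_powR => x /=; rewrite in_itv/= => /andP[ax _].
  exact: lt_le_trans ax.
- have cF (x : R) : 0 < x -> c^-1 * y `^ c @[y --> x] --> c^-1 * x `^ c.
    by move=> x0; apply: cvgMr; exact: continuous_powR_gt0.
  split.
  + move=> x; rewrite in_itv/= => /andP[ax _].
    by have [] := is_derive1_power_primitive cn0 (lt_trans a0 ax).
  + by apply: cvg_at_right_filter; exact: cF.
  + by apply: cvg_at_left_filter; exact: cF.
- move=> x; rewrite in_itv/= => /andP[ax _].
  rewrite derive1E.
  by have [_ ->] := is_derive1_power_primitive cn0 (lt_trans a0 ax).
Qed.

Lemma integral_powR_tail (p t : R) : 1 < p -> 0 < t ->
  (\int[leb]_(x in `[t, +oo[) (x `^ (- p))%:E)%E = (t `^ (1 - p) / (p - 1))%:E.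
Proof.
move=> p1 t0; have cn0 : 1 - p != 0 by rewrite lt_eqF// subr_lt0.
have cF (x : R) : 0 < x -> (1 - p)^-1 * y `^ (1 - p) @[y --> x] --> (1 - p)^-1 * x `^ (1 - p).
  by move=> x0; apply: cvgMr; exact: continuous_powR_gt0.
have dF (x : R) : t < x -> is_derive x 1 (fun y => (1 - p)^-1 * y `^ (1 - p)) (x `^ (- p)).
  move=> tx; have := is_derive1_power_primitive cn0 (lt_trans t0 tx).
  by rewrite (_ : 1 - p - 1 = - p)//; ring.
rewrite (@ge0_continuous_FTC2y _ _ (fun y => (1 - p)^-1 * y `^ (1 - p)) t 0).
- rewrite sub0e -EFinN; congr EFin; field.
  by rewrite cn0 subr_eq0 gt_eqF.
- by move=> x _; rewrite powR_ge0.
- apply: within_continuous_powR => x /=; rewrite in_itv/= andbT.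
  exact: lt_le_trans.
- rewrite -[X in _ --> X](mulr0 (1 - p)^-1); apply: cvgMr.
  have -> : 1 - p = - (p - 1) by ring.
  have p0 : 0 < p - 1 by rewrite subr_gt0.
  apply/cvgrPdist_le => e e0; near=> x.
  have x0 : 0 < x by near: x; apply: nbhs_pinfty_gt; exact: num_real.
  rewrite sub0r normrN ger0_norm ?powR_ge0// powRN.
  rewrite -[leRHS]invrK lef_pV2 ?posrE ?powR_gt0 ?invr_gt0//.
  near: x; apply: (@near_pinfty_powR _ (fun y => e^-1 <= y) _ p0).
  by apply: nbhs_pinfty_ge; exact: num_real.
- by move=> x /dF[].
- by apply: cvg_at_right_filter; exact: cF.
- move=> x; rewrite in_itv/= andbT derive1E => tx.
  by have [_ ->] := dF _ tx.
Unshelve. all: by end_near. Qed.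

Lemma Egamma_fin_num (c : R) : 0 < c -> Egamma c \is a fin_num.
Proof.
move=> c0; rewrite ge0_fin_numE; last first.
  by apply: integral_ge0 => s _; rewrite lee_fin gamma_kernel_ge0.
(* The constant of [gamma_kernel_le] with u = 1 and v = 1/2; the factor 2 undoes the 1/2 in the
   exponential density of rate 1/2. That density dominates beyond 1, the power [g] on ]0, 1]. *)
pose B : R := 2 * (c / (1 - 2^-1)) `^ c.
pose g (s : R) : R := ((fun x => x `^ (c - 1)) \_ `]0, 1]) s.
have g0 s : 0 <= g s by rewrite /g patchE; case: ifP => // _; exact: powR_ge0.
have mg : measurable_fun setT g.
  apply/(measurable_restrictT _ _).1 => //.
  exact: measurable_funTS (measurable_powR _).
have B0 : 0 <= B by rewrite mulr_ge0 ?powR_ge0.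
have me : measurable_fun setT (@exponential_pdf R 2^-1) by exact: measurable_exponential_pdf.
have h20 : 0 < 2^-1 :> R by rewrite invr_gt0.
have e0 s : 0 <= exponential_pdf 2^-1 s :> R by apply: exponential_pdf_ge0; exact: ltW.
apply: (@le_lt_trans _ _ (\int[leb]_s ((g s)%:E + B%:E * (exponential_pdf 2^-1 s)%:E)))%E.
  apply: ge0_le_integral => //.
  - by move=> s _; rewrite lee_fin gamma_kernel_ge0.
  - by apply/measurable_EFinP; exact: measurable_gamma_kernel.
  - by apply: emeasurable_funD; [exact/measurable_EFinP|apply: measurable_funeM; exact/measurable_EFinP].
  - move=> s _; rewrite -EFinM -EFinD lee_fin.
    have [s0|s0] := leP s 0.
      rewrite /gamma_kernel ltNge s0 mul0r; by apply: addr_ge0 => //; apply: mulr_ge0.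
    have [s1|s1] := leP s 1.
      rewrite -[leLHS]addr0; apply: lerD; last by apply: mulr_ge0.
      rewrite /g patchE mem_setE in_itv/= s0 s1.
      rewrite /gamma_kernel s0 !mul1r ler_piMr ?powR_ge0//.
      by rewrite -[leRHS]expR0 ler_expR oppr_le0 ltW.
    rewrite -[leLHS]add0r; apply: lerD => //.
    apply: (@le_trans _ _ (gamma_kernel c 1 s)).
      rewrite /gamma_kernel s0 !mul1r ler_wpM2r ?expR_ge0// ler_powR ?(ltW s1)//.
      by rewrite gerBl.
    apply: le_trans (gamma_kernel_le (v := 2^-1) s _ _) _ => //; first by lra.
    rewrite /exponential_pdf patchE mem_setE in_itv/= andbT (ltW s0) /B mulNr.
    move: (_ `^ c) (expR _) => p e.
    by rewrite (_ : 2 * p * (2^-1 * e) = p * e)//; field.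
rewrite ge0_integralD//; last 4 first.
- by move=> s _; rewrite lee_fin.
- exact/measurable_EFinP.
- by move=> s _; rewrite -EFinM lee_fin mulr_ge0.
- by apply: measurable_funeM; exact/measurable_EFinP.
rewrite ge0_integralZl_EFin//; last 2 first.
- by move=> s _; rewrite lee_fin.
- exact/measurable_EFinP.
rewrite integral_exponential_pdf// mule1 lte_add_pinfty ?ltry//.
apply: (@le_lt_trans _ _ (c^-1)%:E); last by rewrite ltry.
have -> : (\int[leb]_x (g x)%:E = \int[leb]_(x in `]0%R, 1%R]) (x `^ (c - 1))%:E)%E.
  rewrite [RHS]integral_mkcond; apply: eq_integral => s _.
  by rewrite /g !patchE; case: ifP.
(* The power may be unbounded at 0, so the primitive is used on the intervals [1/(i+1), 1] and
   monotone convergence does the rest. *)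
rewrite itv_open_bnd_bigcup.
have mF i : measurable `[(0 + i.+1%:R^-1 : R), 1] by [].
have Hc : (\int[leb]_(x in [set` `[0 + i.+1%:R^-1, 1]%R]) (x `^ (c - 1))%:E)%E
    @[i --> \oo] -->
    (\int[leb]_(x in \bigcup_i [set` `[0 + i.+1%:R^-1, 1]%R]) (x `^ (c - 1))%:E)%E.
  apply: ge0_nondecreasing_set_cvg_integral => //.
  - move=> n m nm; apply/subsetPset => x /=; rewrite !in_itv/= !add0r.
    move=> /andP[nx ->]; rewrite andbT (le_trans _ nx)//.
    by rewrite lef_pV2 ?posrE// ler_nat.
  - by move=> i; apply/measurable_EFinP; exact: measurable_funTS (measurable_powR _).
  - by move=> i x _; rewrite lee_fin powR_ge0.
rewrite -(cvg_lim _ Hc)//; apply: lime_le; first by apply/cvg_ex; eexists; exact: Hc.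
near=> i; rewrite integral_powR_near0//.
  rewrite lee_fin ler_piMr ?invr_ge0 ?(ltW c0)// gerBl powR_ge0//.
rewrite add0r invr_gt0 ltr0Sn/= invf_lt1// ltr1n ltnS.
by near: i; exact: nbhs_infty_gt.
Unshelve. all: by end_near. Qed.

End power_integrals.

(** * Tauberian theorem for Laplace moments *)

Section tauberian.
Variable R : realType.
Local Notation leb := (@lebesgue_measure R).

Lemma laplace_moment_lebesgue (c u : R) : 0 < u ->
  laplace_moment leb (fun y : measurableTypeR R => y : R) (c - 1) u =
  (Egamma c * (u `^ (- c))%:E)%E.
Proof. exact: integral_gamma_kernel. Qed.

Lemma laplace_moment_step d (T : measurableType d)
    (m : {measure set T -> \bar R}) (f : T -> R) (a b K : R) :
  measurable_fun setT f ->
  (forall u, 0 < u -> laplace_moment m f a u \is a fin_num) ->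
  (forall u, 0 < u -> laplace_moment m f (a + 1) u \is a fin_num) ->
  fine (laplace_moment m f a u) * u `^ b @[u --> +oo] --> K ->
  fine (laplace_moment m f (a + 1) u) * u `^ (b + 1) @[u --> +oo] --> K * b.
Proof.
move=> mf fin0 fin1; apply: (@monotone_density _ _ _ _ _ 0) => u v u0 uv.
have v0 := lt_le_trans u0 uv.
move: (fin0 _ u0) (fin0 _ v0) (fin1 _ u0) (fin1 _ v0).
move: (laplace_moment_increment m a mf uv).
move: (laplace_moment m f a u) (laplace_moment m f a v).
move: (laplace_moment m f (a + 1) u) (laplace_moment m f (a + 1) v).
move=> p q r s + /fineK rE /fineK sE /fineK pE /fineK qE.
rewrite -rE -sE -pE -qE -!EFinM -!EFinD !lee_fin /= => -[H1 H2].
by rewrite lerBrDr H1 lerBlDr H2.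
Qed.

Lemma Gamma_gt0 (c : R) : 0 < c -> 0 < Gamma c.
Proof.
move=> c0; rewrite GammaE fine_gt0//; apply/andP; split; last first.
  by rewrite -ge0_fin_numE ?Egamma_fin_num//; apply: integral_ge0 => s _; rewrite lee_fin gamma_kernel_ge0.
(* On [1, 2] the power x^(c-1) is at least 1 or at least 2^(c-1), according to the sign of c - 1. *)
pose k : R := Num.min 1 (2 `^ (c - 1)) * expR (- 2).
have k0 : 0 < k by rewrite mulr_gt0 ?expR_gt0// lt_min ltr01 powR_gt0.
apply: (@lt_le_trans _ _ (\int[leb]_(x in `[1%R, 2%R]) k%:E)%E).
  rewrite integral_cst//= lebesgue_measure_itv/= lte_fin ltr1n -EFinB.
  by rewrite -EFinM lte_fin mulr_gt0// subr_gt0 ltr1n.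
rewrite /Egamma (@le_trans _ _ (\int[leb]_(x in `[1%R, 2%R]) (gamma_kernel (c - 1) 1 x)%:E)%E)//.
  apply: ge0_le_integral => //.
  - by move=> x _; rewrite lee_fin ltW.
  - apply/measurable_EFinP/measurable_funTS; exact: measurable_gamma_kernel.
  - move=> x /=; rewrite in_itv/= => /andP[x1 x2]; rewrite lee_fin.
    have x0 : 0 < x by lra.
    rewrite /gamma_kernel x0 !mul1r /k ler_pM ?expR_ge0//; last by rewrite ler_expR lerN2.
    have [c1|c1] := leP 0 (c - 1).
      rewrite ge_min; apply/orP; left; rewrite -[leLHS](powRr0 x).
      by apply: ler_powR.
    rewrite ge_min; apply/orP; right.
    have [r r0 ->] : exists2 r, 0 <= r & c - 1 = - r by exists (1 - c); lra.
    rewrite !powRN lef_pV2 ?posrE ?powR_gt0//.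
    by apply: ge0_ler_powR => //; rewrite ?nnegrE; lra.
apply: ge0_subset_integral => //.
- by apply/measurable_EFinP; exact: measurable_gamma_kernel.
- by move=> x _; rewrite lee_fin gamma_kernel_ge0.
Qed.

(** For Lebesgue measure the normalized moments are constant in u, equal to Gamma b and Gamma (b +
    1); [laplace_moment_step] and uniqueness of limits relate the two. *)
Lemma Gamma_succ (b : R) : 0 < b -> Gamma (b + 1) = Gamma b * b.
Proof.
move=> b0; have b1 : 0 < b + 1 by lra.
have mid : measurable_fun setT (fun y : measurableTypeR R => y : R) by exact: measurable_id.
have bE : b - 1 + 1 = b + 1 - 1 by ring.
have fineE c u : 0 < c -> 0 < u ->
    fine (laplace_moment leb (fun y : measurableTypeR R => y : R) (c - 1) u) * u `^ c = Gamma c.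
  move=> c0 u0; rewrite laplace_moment_lebesgue// -(fineK (Egamma_fin_num c0)) -EFinM/=.
  by rewrite -GammaE -mulrA powRN mulVf ?mulr1// gt_eqF// powR_gt0.
have fin c : 0 < c -> forall u, 0 < u ->
    laplace_moment leb (fun y : measurableTypeR R => y : R) (c - 1) u \is a fin_num.
  by move=> c0 u u0; rewrite laplace_moment_lebesgue// fin_numM ?Egamma_fin_num.
have H : fine (laplace_moment leb (fun y : measurableTypeR R => y : R) (b - 1 + 1) u)
    * u `^ (b + 1) @[u --> +oo] --> Gamma b * b.
  apply: (laplace_moment_step mid (fin _ b0)); first by rewrite bE; exact: fin.
  apply: (@cvg_near_eq _ _ _ _ (fun=> Gamma b)); last exact: cvg_cst.
  near=> u; have u0 : 0 < u by near: u; apply: nbhs_pinfty_gt; exact: num_real.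
  by rewrite fineE.
apply/esym; rewrite -(cvg_lim _ H)//.
have H2 : (fun _ : R => Gamma (b + 1)) @ (pinfty_nbhs R) --> Gamma (b + 1) by exact: cvg_cst.
apply: cvg_lim => //; apply: cvg_near_eq H2; near=> u.
have u0 : 0 < u by near: u; apply: nbhs_pinfty_gt; exact: num_real.
by rewrite bE fineE.
Unshelve. all: by end_near. Qed.

Lemma measurable_laplace_moment d (T : measurableType d)
    (m : {sigma_finite_measure set T -> \bar R}) (f : T -> R) (a : R)
    dX (X : measurableType dX) (u : X -> R) :
  measurable_fun setT f -> measurable_fun setT u ->
  measurable_fun setT (fun s => laplace_moment m f a (u s)).
Proof.
move=> mf mu.
apply: (@measurable_fun_fubini_tonelli_F _ _ _ _ _ m
  (fun p : X * T => (gamma_kernel a (u p.1) (f p.2))%:E)).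
- apply/measurable_EFinP; apply: measurable_gamma_kernel.
  + exact: (measurableT_comp mu).
  + exact: (measurableT_comp mf).
- by move=> p; rewrite lee_fin gamma_kernel_ge0.
Qed.

(** The Abel integral at u involves only the levels u + s with s > 0, and carries the same factor
    Gamma c on both sides, so a bound between the higher moments descends with the same [k]. Two
    exponents [a1] and [a2] are allowed because, for Lebesgue measure, exponent b - 1 corresponds to
    decay u^(-b). *)
Lemma laplace_moment_comparison d1 d2 (T1 : measurableType d1)
    (T2 : measurableType d2) (m1 : {sigma_finite_measure set T1 -> \bar R})
    (m2 : {sigma_finite_measure set T2 -> \bar R}) (f1 : T1 -> R) (f2 : T2 -> R)
    (a1 a2 c u k : R) : measurable_fun setT f1 -> measurable_fun setT f2 ->
  0 < c -> 0 <= k ->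
  (forall v, u < v ->
    (laplace_moment m1 f1 (a1 + c) v <= k%:E * laplace_moment m2 f2 (a2 + c) v)%E) ->
  (laplace_moment m1 f1 a1 u <= k%:E * laplace_moment m2 f2 a2 u)%E.
Proof.
move=> mf1 mf2 c0 k0 Hk.
have cfin := Egamma_fin_num c0.
have A1 := laplace_moment_abel m1 a1 u mf1 cfin.
have A2 := laplace_moment_abel m2 a2 u mf2 cfin.
have G0 := Gamma_gt0 c0.
have mg : measurable_fun setT (fun s : measurableTypeR R => (gamma_kernel (c - 1) 0 s)%:E).
  by apply/measurable_EFinP; exact: measurable_gamma_kernel.
have mu : measurable_fun setT (fun s : measurableTypeR R => u + s).
  exact: measurable_funD.
rewrite -(@lee_pmul2l _ (Gamma c)%:E) ?lte_fin// -A1 muleCA -A2.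
rewrite -ge0_integralZl_EFin//; last 2 first.
- by move=> s _; rewrite mule_ge0 ?laplace_moment_ge0// lee_fin gamma_kernel_ge0.
- by apply: emeasurable_funM => //; exact: measurable_laplace_moment.
apply: ge0_le_integral => //.
- by move=> s _; rewrite mule_ge0 ?laplace_moment_ge0// lee_fin gamma_kernel_ge0.
- by apply: emeasurable_funM => //; exact: measurable_laplace_moment.
- apply: measurable_funeM.
  by apply: emeasurable_funM => //; exact: measurable_laplace_moment.
- move=> s _; have [s0|s0] := ltP 0 s; last first.
    by rewrite /gamma_kernel ltNge s0 mul0r !mul0e mule0.
  rewrite muleCA lee_wpmul2l ?lee_fin ?gamma_kernel_ge0//.
  by apply: Hk; lra.
Qed.

End tauberian.

(** * Shifting the exponent by half-integers *)

Section half_integer_shift.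
Variable R : realType.
Local Notation leb := (@lebesgue_measure R).
Context d (T : measurableType d) (m : {sigma_finite_measure set T -> \bar R}).
Variables (f : T -> R).
Hypothesis mf : measurable_fun setT f.
Hypothesis fin : forall a u, 0 < a -> 0 < u -> laplace_moment m f a u \is a fin_num.
Local Notation H := (fun a u => fine (laplace_moment m f a u)).

(** Comparison in both directions with Lebesgue measure, whose moments at exponents b - 1 + c and b
    - 1 are exactly Gamma (b + c) v^(-(b + c)) and Gamma b v^(-b). The quotient of these constants
    is the one in the limit. *)
Lemma laplace_moment_downshift (a b c K : R) : 0 < a -> 0 < b -> 0 < c -> 0 < K ->
  H (a + c) u * u `^ (b + c) @[u --> +oo] --> K ->
  H a u * u `^ b @[u --> +oo] --> K * (Gamma b / Gamma (b + c)).
Proof.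
move=> a0 b0 c0 K0 HK.
have bc0 : 0 < b + c by rewrite addr_gt0.
have ac0 : 0 < a + c by rewrite addr_gt0.
have Gb := Gamma_gt0 b0; have Gbc := Gamma_gt0 bc0.
have mid : measurable_fun setT (fun y : measurableTypeR R => y : R) by exact: measurable_id.
have lebE v : 0 < v -> laplace_moment leb (fun y : measurableTypeR R => y : R) (b - 1 + c) v
    = (Gamma (b + c) / v `^ (b + c))%:E.
  move=> v0; rewrite (_ : b - 1 + c = b + c - 1); last by ring.
  by rewrite laplace_moment_lebesgue// -(fineK (Egamma_fin_num bc0)) -GammaE -EFinM powRN.
have lebE' v : 0 < v -> laplace_moment leb (fun y : measurableTypeR R => y : R) (b - 1) v
    = (Gamma b / v `^ b)%:E.
  move=> v0.
  by rewrite laplace_moment_lebesgue// -(fineK (Egamma_fin_num b0)) -GammaE -EFinM powRN.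
move: Gb Gbc lebE lebE'.
(* From here on [x] stands for Gamma b and [y] for Gamma (b + c). *)
move: (Gamma b) (Gamma (b + c)) => x y Gb Gbc lebE lebE'.
have upper K1 : K < K1 -> \forall u \near +oo, H a u * u `^ b <= K1 * (x / y).
  move=> KK1; have K10 := lt_trans K0 KK1.
  have /near_pinftyP[M HM] : \forall u \near +oo, H (a + c) u * u `^ (b + c) < K1 by apply: cvgr_lt HK _ _.
  apply/near_pinftyP; exists (Num.max M 1) => u; rewrite ge_max => /andP[Mu u1].
  have u0 : 0 < u by lra.
  have := @laplace_moment_comparison _ _ _ _ _ m leb f (fun y : measurableTypeR R => y : R)
    a (b - 1) c u (K1 / y) mf mid c0.
  rewrite lebE'// -(fineK (fin a0 u0)) -EFinM lee_fin => Hc.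
  rewrite -ler_pdivlMr ?powR_gt0// (le_trans (Hc _ _))//.
  - by rewrite divr_ge0 ?ltW.
  - move=> v uv; have v0 := lt_trans u0 uv.
    rewrite lebE// -(fineK (fin ac0 v0)) -EFinM lee_fin.
    have := HM v (ltW (le_lt_trans Mu uv)); rewrite -ltr_pdivlMr ?powR_gt0// => /ltW/le_trans; apply.
    by rewrite le_eqVlt; apply/orP; left; apply/eqP; field; rewrite !gt_eqF// powR_gt0.
  - by rewrite le_eqVlt; apply/orP; left; apply/eqP; field; rewrite !gt_eqF// powR_gt0.
have lower K2 : 0 < K2 -> K2 < K -> \forall u \near +oo, K2 * (x / y) <= H a u * u `^ b.
  move=> K20 K2K.
  have /near_pinftyP[M HM] : \forall u \near +oo, K2 < H (a + c) u * u `^ (b + c) by apply: cvgr_gt HK _ _.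
  apply/near_pinftyP; exists (Num.max M 1) => u; rewrite ge_max => /andP[Mu u1].
  have u0 : 0 < u by lra.
  have := @laplace_moment_comparison _ _ _ _ _ leb m (fun y : measurableTypeR R => y : R) f
    (b - 1) a c u (y / K2) mid mf c0.
  rewrite lebE'// -(fineK (fin a0 u0)) -EFinM lee_fin => Hc.
  rewrite -ler_pdivrMr ?powR_gt0//.
  have {}Hc : x / u `^ b <= y / K2 * H a u.
    apply: Hc; first by rewrite divr_ge0 ?ltW.
    move=> v uv; have v0 := lt_trans u0 uv.
    rewrite lebE// -(fineK (fin ac0 v0)) -EFinM lee_fin.
    have := HM v (ltW (le_lt_trans Mu uv)); rewrite -ltr_pdivrMr ?powR_gt0// => /ltW Hv.
    have := ler_wpM2l (ltW (divr_gt0 Gbc K20)) Hv; apply: le_trans.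
    by rewrite le_eqVlt; apply/orP; left; apply/eqP; field; rewrite !gt_eqF// powR_gt0.
  have := ler_wpM2l (ltW (divr_gt0 K20 Gbc)) Hc; rewrite mulrA.
  have -> : K2 / y * (y / K2 * H a u) = H a u.
    by field; rewrite !gt_eqF.
  apply: le_trans; rewrite le_eqVlt; apply/orP; left; apply/eqP; field.
  by rewrite !gt_eqF// powR_gt0.
have G0 : 0 < x / y by rewrite divr_gt0.
exact: squeeze_scaled_cvg G0 K0 upper lower.
Qed.

Lemma laplace_moment_iter_step (a b K : R) (k : nat) : 0 < a -> 0 < b ->
  H a u * u `^ b @[u --> +oo] --> K ->
  H (a + k%:R) u * u `^ (b + k%:R) @[u --> +oo] --> K * (Gamma (b + k%:R) / Gamma b).
Proof.
move=> a0 b0 HK; elim: k => [|k IH].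
  by rewrite !addr0 divff ?mulr1// gt_eqF// Gamma_gt0.
have ak : 0 < a + k%:R by rewrite ltr_pwDl.
have bk : 0 < b + k%:R by rewrite ltr_pwDl.
have := laplace_moment_step mf (fun u => fin ak) (fun u => fin (addr_gt0 ak ltr01)) IH.
have eS x : x + k.+1%:R = x + k%:R + 1 :> R by rewrite -natr1 addrA.
by rewrite !eS Gamma_succ// -mulrA mulrAC.
Qed.

(** Differentiation raises the exponent by integers, the Abel integral lowers it by any positive
    amount. For odd n one therefore overshoots to (n + 1) / 2 and comes down by 1/2; the
    intermediate Gamma cancels. *)
Lemma laplace_moment_half_shift (a b K : R) (n : nat) : 0 < a -> 0 < b -> 0 < K ->
  H a u * u `^ b @[u --> +oo] --> K ->
  H (a + n%:R / 2) u * u `^ (b + n%:R / 2) @[u --> +oo] -->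
    K * (Gamma (b + n%:R / 2) / Gamma b).
Proof.
move=> a0 b0 K0 HK; set k := uphalf n.
have n0 : 0 <= n%:R / 2 :> R by rewrite divr_ge0.
have an : 0 < a + n%:R / 2 by lra.
have bn : 0 < b + n%:R / 2 by lra.
have [no|ne] := boolP (odd n); last first.
  have -> : n%:R / 2 = k%:R :> R.
    by rewrite /k uphalf_half (negbTE ne) add0n -[in LHS](odd_double_half n) (negbTE ne) add0n -muln2 natrM mulfK.
  exact: laplace_moment_iter_step.
have kE : n%:R / 2 + 2^-1 = k%:R :> R.
  have nE : n%:R = 1 + n./2%:R * 2 :> R.
    by rewrite -[in LHS](odd_double_half n) no -muln2 natrD natrM.
  by rewrite /k uphalf_half no natrD nE/=; field.
have bk : 0 < b + k%:R by rewrite ltr_pwDl.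
have := laplace_moment_iter_step (k := k) a0 b0 HK.
rewrite -kE !addrA => /(laplace_moment_downshift an bn _ _).
have Gb := Gamma_gt0 b0; have Gbn := Gamma_gt0 bn; have Gbk := Gamma_gt0 bk.
rewrite -addrA kE => Hd.
have -> : K * (Gamma (b + n%:R / 2) / Gamma b) = K * (Gamma (b + k%:R) / Gamma b) * (Gamma (b + n%:R / 2) / Gamma (b + k%:R)).
  move: (Gamma _) (Gamma _) (Gamma _) Gb Gbn Gbk => x y z x0 y0 z0.
  by field; rewrite !gt_eqF.
by apply: Hd; [rewrite invr_gt0|exact: mulr_gt0 K0 (divr_gt0 Gbk Gb)].
Qed.

End half_integer_shift.

Lemma laplace_moment_fin_num (R : realType) d (T : measurableType d)
    (P : probability T R) (f : T -> R) (a u : R) :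
  measurable_fun setT f -> 0 < a -> 0 < u ->
  laplace_moment P f a u \is a fin_num.
Proof.
move=> mf a0 u0; rewrite ge0_fin_numE ?laplace_moment_ge0//.
apply: (@le_lt_trans _ _ (\int[P]_w ((a / u) `^ a)%:E)%E).
  apply: ge0_le_integral => //.
  - by move=> w _; rewrite lee_fin gamma_kernel_ge0.
  - by apply/measurable_EFinP; exact: measurable_gamma_kernel.
  - move=> w _; rewrite lee_fin; have := gamma_kernel_le (f w) a0 u0.
    by rewrite subr0 mul0r oppr0 expR0 mulr1.
by rewrite integral_cst//= [X in (_ * X)%E]probability_setT mule1 ltry.
Qed.

(** * Gaussian vectors and the law of the radius *)

Section density.
Local Open Scope ereal_scope.
Context d (T : measurableType d) (R : realType).
Variables (mu nu : {measure set T -> \bar R}) (f : T -> R).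
Hypotheses (mf : measurable_fun setT f) (f0 : forall x, (0 <= f x)%R).
Hypothesis nuE : forall A, measurable A -> nu A = \int[mu]_(x in A) (f x)%:E.

Import HBNNSimple.

Let ge0_integral_density_nnsfun (h : {nnsfun T >-> R}) :
  \int[nu]_x (h x)%:E = \int[mu]_x ((f x)%:E * (h x)%:E).
Proof.
under [LHS]eq_integral do rewrite fimfunE -fsumEFin//.
rewrite [LHS]ge0_integral_fsum//; last 2 first.
  - by move=> r; exact/measurable_EFinP/measurableT_comp.
  - by move=> n x _; rewrite EFinM nnfun_muleindic_ge0.
under [RHS]eq_integral.
  move=> x xD; rewrite fimfunE -fsumEFin// ge0_mule_fsumr; last first.
    by move=> r; rewrite EFinM nnfun_muleindic_ge0.
  over.
rewrite [RHS]ge0_integral_fsum//; last 2 first.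
  - move=> r; apply: emeasurable_funM; first exact/measurable_EFinP.
    by apply/measurable_EFinP/measurableT_comp.
  - move=> n x _; apply: mule_ge0; first by rewrite lee_fin.
    by rewrite EFinM nnfun_muleindic_ge0.
apply: eq_fsbigr => r _.
under [RHS]eq_integral do rewrite EFinM muleCA.
have [r0|r0] := leP 0%R r; last first.
  have -> : h @^-1` [set r] = set0 by exact: preimage_nnfun0.
  rewrite [LHS]integral0_eq; last by move=> x _; rewrite indicE in_set0 mulr0.
  by rewrite [RHS]integral0_eq// => x _; rewrite indicE in_set0 !mule0.
have mh : measurable (h @^-1` [set r]) by exact: measurable_funPTI.
rewrite [RHS]ge0_integralZl_EFin//; last 2 first.
  - by move=> x _; rewrite mule_ge0 ?lee_fin.
  - apply: emeasurable_funM; first exact/measurable_EFinP.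
    by apply/measurable_EFinP.
under [LHS]eq_integral do rewrite EFinM.
rewrite ge0_integralZl_EFin//; last exact/measurable_EFinP/measurable_indic.
suff -> : \int[nu]_x (\1_(h @^-1` [set r]) x)%:E =
    \int[mu]_x ((f x)%:E * (\1_(h @^-1` [set r]) x)%:E) by [].
rewrite integral_indic// setIT nuE// [LHS]integral_mkcond.
apply: eq_integral => x _; rewrite patchE indicE.
by case: ifP => _; rewrite ?mule1 ?mule0.
Qed.

Lemma ge0_integral_density (g : T -> \bar R) : measurable_fun setT g ->
  (forall x, 0 <= g x) ->
  \int[nu]_x g x = \int[mu]_x ((f x)%:E * g x).
Proof.
move=> mg g0; pose g_ := nnsfun_approx measurableT mg.
have gE x : g x = limn (fun n => (g_ n x)%:E).
  by apply/esym/cvg_lim => //; exact: cvg_nnsfun_approx.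
transitivity (limn (fun n => \int[nu]_x (g_ n x)%:E)).
  rewrite -monotone_convergence//=.
  - by apply: eq_integral => x _.
  - by move=> n; exact/measurable_EFinP.
  - by move=> n x _; rewrite lee_fin.
  - by move=> x _ a b ab; rewrite lee_fin//; exact/lefP/nd_nnsfun_approx.
transitivity (limn (fun n => \int[mu]_x ((f x)%:E * (g_ n x)%:E))).
  by congr (limn _); apply/funext => n; exact: ge0_integral_density_nnsfun.
rewrite -monotone_convergence//=.
- apply: eq_integral => x _; rewrite gE; apply: limeMl => //.
  apply/cvg_ex; exists (g x); exact: cvg_nnsfun_approx.
- move=> n; apply: emeasurable_funM; exact/measurable_EFinP.
- by move=> n x _; rewrite mule_ge0 ?lee_fin.
- move=> x _ a b ab; rewrite lee_wpmul2l ?lee_fin//; exact/lefP/nd_nnsfun_approx.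
Qed.

End density.

Section density_measure.
Local Open Scope ereal_scope.
Context d (T : measurableType d) (R : realType).
Variables (mu : {measure set T -> \bar R}) (f : {mfun T >-> R}).

(** The absolute value lets every measurable function define a measure, so that the structure
    carries no sign condition. *)
Definition density_measure (A : set T) : \bar R := \int[mu]_(x in A) `|f x|%:E.

Let density_measure0 : density_measure set0 = 0.
Proof. exact: integral_set0. Qed.

Let density_measure_ge0 A : 0 <= density_measure A.
Proof. by apply: integral_ge0 => x _; rewrite lee_fin. Qed.

Let density_measure_sigma_additive : semi_sigma_additive density_measure.
Proof.
move=> F mF tF mUF; rewrite /density_measure ge0_integral_bigcup//.
- by apply: is_cvg_ereal_nneg_natsum_cond => n _ _; exact: density_measure_ge0.
- by apply/measurable_EFinP/measurable_funTS/measurableT_comp.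
Qed.

HB.instance Definition _ := isMeasure.Build _ _ _ density_measure
  density_measure0 density_measure_ge0 density_measure_sigma_additive.

End density_measure.

Section gaussian_power.
Variable R : realType.
Local Notation leb := (@lebesgue_measure R).

Definition sqnorm n (z : 'cV[R]_n) : R := \sum_i z i ord0 ^+ 2.

Lemma sqnorm_ge0 n (z : 'cV[R]_n) : 0 <= sqnorm z.
Proof. by apply: sumr_ge0 => i _; exact: sqr_ge0. Qed.

Lemma sqnormZ n (y : R) (z : 'cV[R]_n) : sqnorm (y *: z) = y ^+ 2 * sqnorm z.
Proof. by rewrite /sqnorm mulr_sumr; apply: eq_bigr => i _; rewrite mxE exprMn. Qed.

Lemma sqnorm_cons n (s : measurableTypeR R) (v : 'cV[R]_n) :
  sqnorm (cons_cV (s, v)) = s ^+ 2 + sqnorm v.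
Proof.
rewrite /sqnorm big_ord_recl; congr (_ + _).
  congr (_ ^+ 2); rewrite /cons_cV (_ : ord0 = @lshift 1 n ord0); last exact/val_inj.
  by apply: etrans (@col_mxEu _ 1 n 1 _ _ _ _) _; rewrite mxE eqxx mulr1n.
apply: eq_bigr => i _; congr (_ ^+ 2).
rewrite /cons_cV (_ : lift ord0 i = @rshift 1 n i); last exact/val_inj.
exact: (@col_mxEd _ 1 n 1).
Qed.

Lemma measurable_sqnorm n : measurable_fun setT (@sqnorm n).
Proof.
apply: measurable_sum => i; apply: measurable_funX.
exact: measurable_coord.
Qed.

Lemma scale_cons_cV n (y : R) (s : measurableTypeR R) (v : 'cV[R]_n) :
  y *: cons_cV (s, v) = cons_cV ((y * s : measurableTypeR R), y *: v).
Proof. by rewrite /cons_cV/= (scale_col_mx y (s%:M : 'M[R]_(1, 1)) v) scale_scalar_mx. Qed.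

Lemma measurable_scale_cV n (y : R) :
  measurable_fun setT (fun z : 'cV[R]_n => y *: z).
Proof.
apply/measurable_fun_cVP => i.
rewrite (_ : (fun _ => _) = (fun z : 'cV[R]_n => y * z i ord0)).
  by apply: measurable_funM => //; exact: measurable_coord.
by apply/funext => z; rewrite mxE.
Qed.

Lemma ge0_integral_cons
    (mu : {sigma_finite_measure set (measurableTypeR R) -> \bar R}) n
    (nu : {sigma_finite_measure set 'cV[R]_n -> \bar R})
    (phi : 'cV[R]_n.+1 -> \bar R) :
  measurable_fun setT phi -> (forall z, 0 <= phi z)%E ->
  (\int[cons_measure mu nu]_z phi z =
   \int[mu]_s \int[nu]_v phi (cons_cV (s, v)))%E.
Proof.
move=> mphi phi0.
have mc := @measurable_cons_cV R n.
transitivity (\int[(mu \x nu)%E]_p (phi \o (@cons_cV R n)) p)%E.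
  by rewrite /cons_measure (ge0_integral_pushforward mc).
by rewrite fubini_tonelli1//=; exact: measurableT_comp.
Qed.

(** The density of y times a standard Gaussian vector of R^n, as a function of the squared norm u:
    (S / pi)^(n/2) exp(-u S) with S = 1 / (2 y^2). It is 0 at y = 0, where the inverse is 0 and the
    kernel vanishes. *)
Definition gaussian_density n (y u : R) : R :=
  pi `^ (- (n%:R / 2)) * gamma_kernel (n%:R / 2) u (2 * y ^+ 2)^-1.

Lemma gaussian_density_ge0 n y u : 0 <= gaussian_density n y u.
Proof. by rewrite mulr_ge0 ?powR_ge0 ?gamma_kernel_ge0. Qed.

Lemma gaussian_densityD n y u v : 0 < y ->
  gaussian_density n.+1 y (u + v) = gaussian_density 1 y u * gaussian_density n y v.
Proof.
move=> y0; have S0 : 0 < (2 * y ^+ 2)^-1 by rewrite invr_gt0 mulr_gt0// exprn_gt0.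
have n1 : n.+1%:R / 2 = 2^-1 + n%:R / 2 :> R by rewrite -natr1; field.
rewrite /gaussian_density; move: (_^-1) S0 => S S0; rewrite /gamma_kernel S0 !mul1r n1.
have -> : - ((u + v) * S) = - (u * S) + - (v * S) by ring.
rewrite opprD !powRD ?(gt_eqF S0) ?implybT ?(gt_eqF (pi_gt0 R)) ?implybT//.
by rewrite expRD; ring.
Qed.

Lemma gaussian_density1 (y s : R) : 0 < y ->
  gaussian_density 1 y (s ^+ 2) = y^-1 * normal_pdf 0 1 (y^-1 * s).
Proof.
move=> y0; have S0 : 0 < (2 * y ^+ 2)^-1 by rewrite invr_gt0 mulr_gt0// exprn_gt0.
have yn0 : y != 0 by rewrite gt_eqF.
rewrite normal_pdfE ?oner_eq0// /normal_peak /normal_fun /gaussian_density.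
rewrite /gamma_kernel S0 [true%:R * _]mul1r mulrA [RHS]mulrA; congr (_ * _); last first.
  by congr expR; rewrite subr0; field.
rewrite div1r powRN !powR12_sqrt ?pi_ge0 ?(ltW S0)//.
have -> : Num.sqrt (2 * y ^+ 2)^-1 = (Num.sqrt 2 * y)^-1.
  have y2 : 0 <= 2 * y ^+ 2 by rewrite mulr_ge0 ?sqr_ge0.
  by rewrite (sqrtrV y2) sqrtrM// sqrtr_sqr gtr0_norm.
rewrite expr1n mul1r -[pi *+ 2]mulr_natl sqrtrM// !invfM.
by ring.
Qed.

Lemma ge0_integral_normal_scale (y : R) (g : R -> \bar R) : 0 < y ->
  measurable_fun setT g -> (forall s, 0 <= g s)%E ->
  (\int[normal_prob 0 1]_s g (y * s)%R =
   \int[leb]_s ((gaussian_density 1 y (s ^+ 2))%:E * g s))%E.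
Proof.
move=> y0 mg g0.
have mpdf := @measurable_normal_pdf R 0 1.
have mys : measurable_fun setT (fun s : measurableTypeR R => (y * s)%R : measurableTypeR R).
  exact: mulrl_measurable.
rewrite (@ge0_integral_density _ _ _ leb (normal_prob 0 1) (normal_pdf 0 1))//.
- rewrite [RHS](@ge0_integral_lebesgue_scale _ y)//; last 2 first.
  + apply: emeasurable_funM => //; apply/measurable_EFinP; apply: measurable_funM => //.
    apply: measurable_gamma_kernel => //; exact: measurable_funX.
  + by move=> s; rewrite mule_ge0// lee_fin gaussian_density_ge0.
  rewrite -ge0_integralZl_EFin ?(ltW y0)//; last 2 first.
  + by move=> s _; rewrite mule_ge0// lee_fin gaussian_density_ge0.
  + apply: emeasurable_funM; last exact: (measurableT_comp mg mys).
    apply/measurable_EFinP; apply: measurable_funM => //.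
    apply: measurable_gamma_kernel => //; apply: measurable_funX; exact: mys.
  apply: eq_integral => s _; rewrite muleA -EFinM; congr (_%:E * _)%E.
  rewrite gaussian_density1// mulrA divff ?gt_eqF// mul1r; congr normal_pdf.
  by rewrite mulrA mulVf ?gt_eqF// mul1r.
- by move=> s; exact: normal_pdf_ge0.
- exact: (measurableT_comp mg mys).
Qed.

(** Induction along the recursive construction of the power measures: the squared norm splits as s^2
    + |v|^2, and the Gaussian density factors accordingly. *)
Lemma ge0_integral_power_normal_scale n (y : R) (phi : 'cV[R]_n -> \bar R) :
  0 < y -> measurable_fun setT phi -> (forall z, 0 <= phi z)%E ->
  (\int[power_measure (normal_prob (0 : R) 1) n]_z phi (y *: z)%R =
   \int[lebesgue_cV n]_z ((gaussian_density n y (sqnorm z))%:E * phi z))%E.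
Proof.
move=> y0; elim: n phi => [|n IH] phi mphi phi0.
  have e z : phi z = phi 0 by congr phi; apply/colP => -[].
  under eq_integral do rewrite e.
  have S0 : 0 < (2 * y ^+ 2)^-1 by rewrite invr_gt0 mulr_gt0// exprn_gt0.
  have rho0 : gaussian_density 0 y 0 = 1.
    by rewrite /gaussian_density /gamma_kernel S0 !mul0r !oppr0 !powRr0 expR0 !mulr1.
  by under [RHS]eq_integral do rewrite e /sqnorm big_ord0 rho0 mul1e.
have mcons (s : measurableTypeR R) : measurable_fun setT (fun v : 'cV[R]_n => cons_cV (s, v)).
  apply: (measurableT_comp (@measurable_cons_cV R n)).
  exact: measurable_fun_pair.
have mrho m : measurable_fun setT (fun z : 'cV[R]_m => (gaussian_density m y (sqnorm z))%:E).
  apply/measurable_EFinP; apply: measurable_funM => //.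
  by apply: measurable_gamma_kernel => //; exact: measurable_sqnorm.
rewrite /lebesgue_cV/= !ge0_integral_cons//; last 3 first.
- by apply: emeasurable_funM => //; exact: mrho.
- by move=> z; rewrite mule_ge0// lee_fin gaussian_density_ge0.
- exact: (measurableT_comp mphi (measurable_scale_cV _)).
pose G (t : measurableTypeR R) := (\int[lebesgue_cV n]_v
  ((gaussian_density n y (sqnorm v))%:E * phi (cons_cV (t, v))))%E.
have mJ : measurable_fun setT (fun p : measurableTypeR R * 'cV[R]_n =>
    ((gaussian_density n y (sqnorm p.2))%:E * phi (cons_cV p))%E).
  apply: emeasurable_funM; last exact: (measurableT_comp mphi (@measurable_cons_cV R n)).
  exact: (measurableT_comp (mrho n) measurable_snd).
have mG : measurable_fun setT G.
  apply: (measurable_fun_fubini_tonelli_F _ mJ) => p.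
  by rewrite mule_ge0// lee_fin gaussian_density_ge0.
transitivity (\int[normal_prob 0 1]_s G (y * s)%R)%E.
  apply: eq_integral => s _.
  under eq_integral do rewrite scale_cons_cV.
  rewrite (IH (fun v => phi (cons_cV ((y * s)%R : measurableTypeR R, v))))//.
  exact: (measurableT_comp mphi (mcons _)).
rewrite ge0_integral_normal_scale//; last first.
  by move=> s; apply: integral_ge0 => v _; rewrite mule_ge0// lee_fin gaussian_density_ge0.
apply: eq_integral => s _; rewrite /G -ge0_integralZl_EFin ?gaussian_density_ge0//.
- apply: eq_integral => v _; rewrite sqnorm_cons gaussian_densityD// EFinM.
  by rewrite muleA.
- by move=> v _; rewrite mule_ge0// lee_fin gaussian_density_ge0.
- apply: emeasurable_funM; first exact: mrho.
  exact: (measurableT_comp mphi (mcons _)).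
Qed.

End gaussian_power.

Section radial_law.
Context (R : realType) dO (Omega : measurableType dO) (P : probability Omega R).

(** The variable S of the overview. Where [xi] vanishes so does [precision], by the convention on
    the inverse of 0, and with it the kernel: a mass of the radius at 0 does not enter the
    density. *)
Definition precision (xi : Omega -> R) (w : Omega) : R := (2 * xi w ^+ 2)^-1.

Lemma measurable_precision (xi : Omega -> R) : measurable_fun setT xi ->
  measurable_fun setT (precision xi).
Proof.
move=> mxi; have -> : precision xi = (fun w => (2 * xi w ^+ 2) `^ (-1)).
  by apply/funext => w; rewrite /precision powR_inv1// mulr_ge0 ?sqr_ge0.
apply: (measurableT_comp (measurable_powR (-1))).
by apply: measurable_funM => //; exact: measurable_funX.
Qed.

Definition radial_density (xi : Omega -> R) n (u : R) : \bar R :=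
  ((pi `^ (- (n%:R / 2)))%:E * laplace_moment P (precision xi) (n%:R / 2) u)%E.

Lemma radial_density_ge0 xi n u : (0 <= radial_density xi n u)%E.
Proof. by rewrite mule_ge0 ?laplace_moment_ge0// lee_fin powR_ge0. Qed.

Lemma measurable_radial_density (xi : Omega -> R) n dX (X : measurableType dX)
    (u : X -> R) : measurable_fun setT xi -> measurable_fun setT u ->
  measurable_fun setT (fun x => radial_density xi n (u x)).
Proof.
move=> mxi mu; apply: measurable_funeM; apply: measurable_laplace_moment => //.
exact: measurable_precision.
Qed.

Variables (chi xi : {RV P >-> R}) (n : nat).
Hypotheses (chiP : chi_distributed P n chi) (xi0 : forall w, 0 <= xi w)
  (ind : independent2 P chi xi).

(** Given xi = y, the squared radius is distributed as the squared norm of y times a Gaussian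
    vector; Tonelli then averages the Gaussian density over xi. Sets within u > 0 avoid the possible
    atom at 0. *)
Lemma radial_law (A : set R) : measurable A -> A `<=` [set u | 0 < u] ->
  P [set w | A ((chi w * xi w) ^+ 2)] =
  (\int[lebesgue_cV n]_z (radial_density xi n (sqnorm z) * (\1_A (sqnorm z))%:E))%E.
Proof.
move=> mA A0.
pose C : set (R * R) := [set p | A ((p.1 * p.2) ^+ 2)].
have mC : measurable C.
  rewrite -[C]setTI.
  have : measurable_fun setT (fun p : R * R => (p.1 * p.2) ^+ 2).
    by apply: measurable_funX; apply: measurable_funM.
  by move=> /(_ measurableT A mA).
have mpair : measurable_fun setT (fun w => (chi w, xi w)).
  exact: measurable_fun_pair.
pose m' : {measure set (R * R) -> \bar R} := pushforward P (fun w => (chi w, xi w)).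
(* Independence makes the joint law of the pair agree with the product measure on rectangles, hence
   equal to it. *)
have PC : P [set w | A ((chi w * xi w) ^+ 2)] =
    (distribution P chi \x distribution P xi)%E C.
  by rewrite (@product_measure_unique _ _ _ _ _ _ _ (m' mpair)).
rewrite PC -(setIT C) -integral_indic// fubini_tonelli2//=; last first.
  by apply/measurable_EFinP; exact: measurable_indic.
rewrite /fubini_G/=.
pose phi (z : 'cV[R]_n) : \bar R := (\1_A (sqnorm z))%:E.
have mphi : measurable_fun setT phi.
  apply/measurable_EFinP; apply: measurableT_comp; first exact: measurable_indic.
  exact: measurable_sqnorm.
have phi0 z : (0 <= phi z)%E by rewrite lee_fin.
have inner y : (\int[distribution P chi]_s (\1_C (s, y))%:E =
    \int[power_measure (normal_prob (0 : R) 1) n]_z phi (y *: z)%R)%E.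
  pose Cy : set R := [set s | C (s, y)].
  have mCy : measurable Cy.
    rewrite -[Cy]setTI.
    have : measurable_fun setT (fun s : R => (s * y) ^+ 2).
      by apply: measurable_funX; apply: measurable_funM.
    by move=> /(_ measurableT A mA).
  have -> : (fun s => (\1_C (s, y))%:E) = (fun s => (\1_Cy s)%:E :> \bar R).
    by apply/funext => s; rewrite !indicE; congr ((nat_of_bool _)%:R)%:E; apply/idP/idP; rewrite !inE.
  rewrite integral_indic// setIT.
  rewrite [LHS](_ : _ = P (chi @^-1` Cy))//.
  rewrite chiP// /chi2_prob /pushforward.
  set E := _ @^-1` _.
  have EA : E = (fun z : 'cV[R]_n => sqnorm (y *: z)) @^-1` A.
    apply/funext => z; rewrite /E/= /Cy/= /C/= -/(sqnorm z) sqnormZ.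
    by rewrite exprMn sqr_sqrtr ?sqnorm_ge0// mulrC.
  have mE : measurable E.
    rewrite EA -[X in measurable X]setTI.
    exact: (measurableT_comp (@measurable_sqnorm R n) (measurable_scale_cV y)).
  rewrite -[E in LHS]setIT -integral_indic//; apply: eq_integral => z _.
  by rewrite /phi !indicE EA.
under eq_integral do rewrite inner.
have mrho : measurable_fun setT (fun p : Omega * 'cV[R]_n =>
    ((gaussian_density n (xi p.1) (sqnorm p.2))%:E * phi p.2)%E).
  apply: emeasurable_funM; last exact: (measurableT_comp mphi measurable_snd).
  apply/measurable_EFinP; apply: measurable_funM => //.
  apply: measurable_gamma_kernel.
    exact: (measurableT_comp (@measurable_sqnorm R n) measurable_snd).
  exact: (measurableT_comp (@measurable_precision xi _) measurable_fst).
transitivity (\int[P]_w \int[lebesgue_cV n]_z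
    ((gaussian_density n (xi w) (sqnorm z))%:E * phi z))%E.
  have mPsi : measurable_fun setT (fun y : R =>
      \int[power_measure (normal_prob (0 : R) 1) n]_z phi (y *: z)%R)%E.
    apply: (@measurable_fun_fubini_tonelli_F _ _ _ _ _ _
      (fun p : R * 'cV[R]_n => phi (p.1 *: p.2))) => //.
    apply: (measurableT_comp mphi); apply/measurable_fun_cVP => i.
    rewrite (_ : (fun _ => _) = (fun p : R * 'cV[R]_n => p.1 * p.2 i ord0)).
      apply: measurable_funM => //.
      exact: (measurableT_comp (measurable_coord i ord0) measurable_snd).
    by apply/funext => p; rewrite mxE.
  rewrite (ge0_integral_distribution xi mPsi); last by move=> y; exact: integral_ge0.
  apply: eq_integral => w _ /=.
  (* If xi w = 0 both sides are 0: the scaled vector is the origin, whose squared norm is outside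
     [A], and the density vanishes. *)
  have := xi0 w; rewrite le_eqVlt => /orP[/eqP y0|y0]; last first.
    by rewrite ge0_integral_power_normal_scale.
  have A0' : \1_A (0 : R) = 0 :> R.
    rewrite indicE; case: (boolP (_ \in _)) => //; rewrite inE => /A0/=.
    by rewrite ltxx.
  rewrite -y0 !integral0_eq// => z _.
    by rewrite /gaussian_density /gamma_kernel expr0n/= mulr0 invr0 ltxx mul0r mulr0 mul0e.
  by rewrite /phi scale0r /sqnorm big1 ?A0'// => i _; rewrite mxE expr0n.
rewrite (fubini_tonelli _ mrho); last first.
  by move=> p; rewrite mule_ge0// lee_fin gaussian_density_ge0.
apply: eq_integral => z _.
have mk : measurable_fun setT (fun w => gamma_kernel (n%:R / 2) (sqnorm z) (precision xi w)).
  by apply: measurable_gamma_kernel => //; exact: measurable_precision.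
rewrite /= ge0_integralZr//; last 2 first.
- by apply/measurable_EFinP; exact: measurable_funM.
- by move=> w _; rewrite lee_fin gaussian_density_ge0.
congr (_ * _)%E; rewrite /radial_density /laplace_moment.
rewrite -ge0_integralZl_EFin ?powR_ge0//.
- by move=> w _; rewrite lee_fin gamma_kernel_ge0.
- exact/measurable_EFinP.
Qed.

End radial_law.

(** * Density generators *)

Section generator.
Context (R : realType) dO (Omega : measurableType dO) (P : probability Omega R).
Variables (chi : nat -> {RV P >-> R}) (xi : {RV P >-> R})
  (U : forall d : nat, {RV P >-> 'cV[R]_d})
  (c : nat -> R) (g : nat -> R -> \bar R).
Hypotheses (model : radial_model chi xi U) (gen : density_generators chi xi U c g).

Lemma posdefmx1 n : posdefmx (1%:M : 'M[R]_n).
Proof.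
split=> [|v v0]; first exact: trmx1.
rewrite mulmx1 mxE.
have [i vi] : exists i, v i ord0 != 0.
  apply/existsP; apply: contraNT v0 => /existsPn H.
  apply/eqP/colP => i; rewrite mxE; apply/eqP.
  by have := H i; rewrite negbK.
rewrite (bigD1 i)//= ltr_pwDl//.
  by rewrite mxE -expr2 exprn_even_gt0.
by apply: sumr_ge0 => j _; rewrite mxE -expr2 sqr_ge0.
Qed.

Lemma measurable_standard n (e : R) :
  measurable_fun setT (fun w => (e * Defs.radius chi xi n w) *: U n w).
Proof.
apply/measurable_fun_cVP => i.
rewrite (_ : (fun _ => _) = (fun w => e * Defs.radius chi xi n w * U n w i ord0)).
  apply: measurable_funM; first by apply: measurable_funM => //; apply: measurable_funM.
  exact: (measurableT_comp (measurable_coord i ord0) (measurable_funP (U n))).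
by apply/funext => w; rewrite mxE.
Qed.

(** Both signs e = 1 and e = -1 give a standard elliptical vector, with factor e times the identity.
    The first yields the law of the radius, the second the symmetry of the one-dimensional law. *)
Lemma has_density_standard n (e : R) : (0 < n)%N -> e ^+ 2 = 1 ->
  has_density P (fun w => (e * Defs.radius chi xi n w) *: U n w) (lebesgue_cV n)
    (fun z => (c n)%:E * g n (sqnorm z))%E.
Proof.
move=> n0 e1; have mZ := @measurable_standard n e.
pose Zmixin := isMeasurableFun.Build _ _ _ _ _ mZ.
pose Z : {RV P >-> 'cV[R]_n} := HB.pack (fun w => (e * Defs.radius chi xi n w) *: U n w) Zmixin.
have HZ : elliptical chi xi U 0 1%:M Z.
  exists e%:M; first by rewrite tr_scalar_mx -scalar_mxM -expr2 e1.
  move=> B mB; congr (P _); apply/funext => w /=.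
  by rewrite add0r mul_scalar_mx scalerA mulrC.
move=> B mB; rewrite (generator_density gen n0 (posdefmx1 n) HZ mB).
apply: eq_integral => z _; rewrite /elliptical_density det1 sqrtr1 divr1.
congr (_ * g n _)%E; rewrite /mahalanobis subr0 invmx1 mulmx1 mxE.
by apply: eq_bigr => i _; rewrite mxE expr2.
Qed.

Let independent_chi_xi n : (0 < n)%N -> independent2 P (chi n) xi.
Proof.
move=> n0 B1 B2 mB1 mB2.
have := radial_independent model n0 mB1 mB2 measurableT.
by rewrite preimage_setT setIT probability_setT mule1.
Qed.

(** Both sides are the probability that the squared radius lies in [A]: the left one through the
    density of the elliptical vector, the right one through [radial_law]. They agree because U is
    almost surely of norm 1. *)
Lemma generator_integral n (A : set R) : (0 < n)%N -> measurable A ->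
  A `<=` [set u | 0 < u] ->
  (\int[lebesgue_cV n]_(z in @sqnorm R n @^-1` A) ((c n)%:E * g n (sqnorm z)) =
   \int[lebesgue_cV n]_(z in @sqnorm R n @^-1` A) radial_density P xi n (sqnorm z))%E.
Proof.
move=> n0 mA A0.
have mB : measurable (@sqnorm R n @^-1` A).
  by rewrite -[X in measurable X]setTI; exact: measurable_sqnorm.
rewrite -(has_density_standard n0 (expr1n _ _) mB).
rewrite [RHS]integral_mkcond.
transitivity (\int[lebesgue_cV n]_z (radial_density P xi n (sqnorm z) * (\1_A (sqnorm z))%:E))%E; last first.
  apply: eq_integral => z _; rewrite patchE indicE.
  have -> : (z \in @sqnorm R n @^-1` A) = (sqnorm z \in A) by apply/idP/idP; rewrite !inE.
  by case: ifP => _; rewrite ?mule1 ?mule0.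
rewrite -(radial_law (radial_chi model n0) (radial_xi model) (independent_chi_xi n0) mA A0).
have [N [mN PN NE]] := (radial_sphere model n0).1.
have mE1 : measurable ((fun w => (1 * Defs.radius chi xi n w) *: U n w)
    @^-1` (@sqnorm R n @^-1` A)).
  by rewrite -[X in measurable X]setTI; exact: measurable_standard.
have mE2 : measurable [set w | A ((chi n w * xi w) ^+ 2)].
  rewrite -[X in measurable X]setTI.
  have : measurable_fun setT (fun w => (chi n w * xi w) ^+ 2).
    by apply: measurable_funX; apply: measurable_funM.
  by move=> /(_ measurableT A mA).
rewrite -(measureU0 mE1 mN PN) -[RHS](measureU0 mE2 mN PN); congr (P _).
have AE w : ~ N w -> sqnorm ((1 * Defs.radius chi xi n w) *: U n w) = (chi n w * xi w) ^+ 2.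
  move=> Nw; rewrite sqnormZ mul1r /sqnorm.
  by have -> := contrapT (contra_not (NE w) Nw); rewrite mulr1.
apply/seteqP; split => w [Aw|Nw]; try by right.
  have [Nw|Nw] := pselect (N w); first by right.
  by left; move: Aw; rewrite /= AE.
have [Nw|Nw] := pselect (N w); first by right.
by left; move: Aw; rewrite /= AE.
Qed.

(** Two functions with the same integral over every measurable set are equal almost everywhere once
    one of them is integrable, and here the total mass is a probability. The reference measure is
    [W], the image of Lebesgue measure by the squared norm, whose density is never computed. *)
Lemma generator_ae n : (0 < n)%N -> exists N : set R,
  [/\ measurable N, lebesgue_cV n (@sqnorm R n @^-1` N) = 0%E &
    forall u, 0 < u -> ~ N u -> ((c n)%:E * g n u)%E = radial_density P xi n u].
Proof.
move=> n0.
have msq : measurable_fun setT (@sqnorm R n) by exact: measurable_sqnorm.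
pose W0 : {measure set R -> \bar R} := pushforward (lebesgue_cV n) (@sqnorm R n).
pose W := W0 msq.
have mD : measurable (`]0, +oo[ : set R) by [].
have mh : measurable_fun (`]0, +oo[ : set R) (radial_density P xi n).
  by apply: measurable_funTS; apply: measurable_radial_density.
have mg : measurable_fun (`]0, +oo[ : set R) (fun u => (c n)%:E * g n u)%E.
  apply: measurable_funeM; apply: measurable_funS (generator_measurable gen n0) => //.
  by move=> x /=; rewrite !in_itv/= !andbT => /ltW.
have pushE (f : R -> \bar R) (E : set R) : measurable E -> measurable_fun E f ->
    (forall u, E u -> 0 <= f u)%E ->
    (\int[W]_(u in E) f u = \int[lebesgue_cV n]_(z in @sqnorm R n @^-1` E) f (sqnorm z))%E.
  move=> mE mf f0; rewrite /W /W0 (ge0_integral_pushforward msq)// => u /[!inE].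
  exact: f0.
have D0 (E : set R) : E `<=` `]0, +oo[%classic -> E `<=` [set u : R | 0 < u].
  by move=> ED u /ED /=; rewrite in_itv/= andbT.
have g0 (u : R) : 0 < u -> (0 <= (c n)%:E * g n u)%E.
  move=> u0; rewrite mule_ge0 ?(generator_ge0 gen n0 (ltW u0))//.
  by rewrite lee_fin ltW// (generator_coef gen n0).
have EE (E : set R) : E `<=` `]0, +oo[%classic -> measurable E ->
    (\int[W]_(u in E) radial_density P xi n u = \int[W]_(u in E) ((c n)%:E * g n u))%E.
  move=> ED mE; rewrite !pushE//; last 4 first.
  - exact: measurable_funS mg.
  - by move=> u /(D0 _ ED)/= ; exact: g0.
  - exact: measurable_funS mh.
  - by move=> u _; exact: radial_density_ge0.
  by rewrite generator_integral//; exact: D0.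
have hint : W.-integrable (`]0, +oo[ : set R) (radial_density P xi n).
  apply/integrableP; split => //.
  under eq_integral do rewrite gee0_abs ?radial_density_ge0//.
  rewrite EE// pushE//; last by move=> u /(D0 _ (@subset_refl _ _)); exact: g0.
  have mB : measurable (@sqnorm R n @^-1` `]0, +oo[).
    by rewrite -[X in measurable X]setTI; exact: measurable_sqnorm.
  rewrite -(has_density_standard n0 (expr1n _ _) mB).
  apply: (@le_lt_trans _ _ 1%E); last by rewrite ltry.
  apply: probability_le1.
  by rewrite -[X in measurable X]setTI; exact: measurable_standard.
have [N [mN WN HN]] := integral_ae_eq mD hint mg EE.
exists N; split => // u u0 Nu; apply/esym.
move: (contra_not (HN u) Nu) => /contrapT; apply.
by rewrite /= in_itv/= andbT.
Qed.

End generator.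

(** * The radial density and the tail in dimension one *)

Section one_dimensional_tail.
Context (R : realType) dO (Omega : measurableType dO) (P : probability Omega R).
Local Notation leb := (@lebesgue_measure R).

Lemma radial_density_fin_num (xi : Omega -> R) n u : measurable_fun setT xi ->
  (0 < n)%N -> 0 < u -> radial_density P xi n u \is a fin_num.
Proof.
move=> mxi n0 u0; rewrite fin_numM// laplace_moment_fin_num//.
- exact: measurable_precision.
- by rewrite divr_gt0// ltr0n.
Qed.

Lemma radial_density_nonincreasing (xi : Omega -> R) n u v :
  measurable_fun setT xi -> u <= v ->
  (radial_density P xi n v <= radial_density P xi n u)%E.
Proof.
move=> mxi uv; rewrite lee_wpmul2l ?lee_fin ?powR_ge0//.
have mS := measurable_precision mxi.
apply: ge0_le_integral => //.
- by move=> w _; rewrite lee_fin gamma_kernel_ge0.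
- by apply/measurable_EFinP; exact: measurable_gamma_kernel.
- by apply/measurable_EFinP; exact: measurable_gamma_kernel.
- move=> w _; rewrite lee_fin /gamma_kernel; case: ltP => y0; last by rewrite !mul0r.
  by rewrite !mul1r ler_wpM2l ?powR_ge0// ler_expR lerN2 (ler_wpM2r (ltW y0)).
Qed.

Lemma sqnorm1 (z : 'cV[R]_1) : sqnorm z = z ord0 ord0 ^+ 2.
Proof. by rewrite /sqnorm big_ord1. Qed.

Lemma lebesgue_cV1_shell (t1 t2 : R) : 0 < t1 -> t1 <= t2 ->
  lebesgue_cV 1 (@sqnorm R 1 @^-1` `]t1 ^+ 2, t2 ^+ 2]) = (2 * (t2 - t1))%:E.
Proof.
move=> t10 t12; have t20 := lt_le_trans t10 t12.
pose E : set (measurableTypeR R) := `]t1, t2] `|` `[- t2, - t1[.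
have -> : lebesgue_cV 1 (@sqnorm R 1 @^-1` `]t1 ^+ 2, t2 ^+ 2]) =
    (leb \x \d_(0%R : 'cV[R]_0))%E (E `*` setT).
  rewrite /lebesgue_cV/= /cons_measure/= /pushforward; congr (_ _).
  apply/seteqP; split => -[s v]; rewrite /= sqnorm_cons /sqnorm big_ord0 addr0 !in_itv/=.
    move=> /andP[s1 s2]; split => //; rewrite /E/= !in_itv/=.
    have [s0|s0] := leP 0 s; [left|right].
      by rewrite -ltr_sqr ?nnegrE ?(ltW t10)// s1 -ler_sqr ?nnegrE ?(ltW t20).
    have ns0 : 0 <= - s by lra.
    move: s1 s2; rewrite -(sqrrN s) ltr_sqr ?nnegrE ?(ltW t10)//.
    by rewrite ler_sqr ?nnegrE ?(ltW t20)//; lra.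
  rewrite /E/= !in_itv/= => -[[|] /andP[s1 s2] _].
    have s0 : 0 < s by lra.
    by rewrite ltr_sqr ?nnegrE ?(ltW t10) ?(ltW s0)// s1 ler_sqr ?nnegrE ?(ltW s0) ?(ltW t20).
  have ns0 : 0 < - s by lra.
  rewrite -(sqrrN s) ltr_sqr ?nnegrE ?(ltW ns0) ?(ltW t10)//.
  by rewrite ler_sqr ?nnegrE ?(ltW ns0) ?(ltW t20)//; lra.
rewrite product_measure1E//; last exact: measurableU.
rewrite [X in (_ * X)%E]diracT mule1 measureU//; last first.
  apply/seteqP; split => // s [/=]; rewrite !in_itv/= => /andP[a _] /andP[_ b].
  lra.
change (leb `]t1, t2]%classic + leb `[(- t2)%R, (- t1)%R[%classic = (2 * (t2 - t1))%:E)%E.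
rewrite !lebesgue_measure_itv/= !lte_fin.
rewrite ltrN2; case: ifPn => [lt12|].
  by rewrite -!EFinD; congr EFin; ring.
rewrite -leNgt => t21; have -> : t2 = t1 by apply/eqP; rewrite eq_le t21 t12.
by rewrite subrr mulr0 adde0.
Qed.

Variables (chi : nat -> {RV P >-> R}) (xi : {RV P >-> R})
  (U : forall d : nat, {RV P >-> 'cV[R]_d})
  (c : nat -> R) (g : nat -> R -> \bar R).
Hypotheses (model : radial_model chi xi U) (gen : density_generators chi xi U c g).
Local Notation V := (elliptical1 chi xi U).
Local Notation h := (fun u => fine (radial_density P xi 1 u)).

Lemma measurable_elliptical1 : measurable_fun setT V.
Proof.
apply: measurable_funM; first exact: measurable_funM.
exact: (measurableT_comp (measurable_coord ord0 ord0) (measurable_funP (U 1%N))).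
Qed.

(** The vectors obtained with e = 1 and e = -1 have the same density. *)
Let elliptical1N B : measurable B -> P [set w | B (- V w)] = P [set w | B (V w)].
Proof.
move=> mB; pose B' : set 'cV[R]_1 := [set z | B (z ord0 ord0)].
have mB' : measurable B'.
  by rewrite -[X in measurable X]setTI; exact: (@measurable_coord _ _ _ ord0 ord0).
have s1 : (1 : R) ^+ 2 = 1 by rewrite expr1n.
have sN : (- 1 : R) ^+ 2 = 1 by rewrite sqrrN expr1n.
have := has_density_standard gen (ltn0Sn 0) s1 mB'.
rewrite -(has_density_standard gen (ltn0Sn 0) sN mB') => H.
transitivity (P ((fun w => (-1 * Defs.radius chi xi 1 w) *: U 1%N w) @^-1` B')).
  by congr (P _); apply/seteqP; split => w /=; rewrite /B'/= mxE mulN1r mulNr.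
rewrite -H; congr (P _).
by apply/seteqP; split => w /=; rewrite /B'/= mxE mul1r.
Qed.

(** The event that the square of [V] lies in ]t1^2, t2^2] is the disjoint union of one event for [V]
    and the same event for [- V], equally likely by symmetry. *)
Lemma elliptical1_itv (t1 t2 : R) : 0 < t1 -> t1 <= t2 ->
  (2%:E * P [set w | (t1 < V w <= t2)%R] =
   \int[lebesgue_cV 1]_(z in @sqnorm R 1 @^-1` [set` `]t1 ^+ 2, t2 ^+ 2]%R])
     radial_density P xi 1 (sqnorm z))%E.
Proof.
move=> t10 t12; have t20 := lt_le_trans t10 t12.
have mV := measurable_elliptical1.
have mE B : measurable B -> measurable [set w | B (V w)].
  by move=> mB; rewrite -[X in measurable X]setTI; exact: mV.
have mI : measurable (`]t1, t2] : set R) by [].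
rewrite -(generator_integral model gen (ltn0Sn 0))//; last first.
  by move=> u; rewrite /= in_itv/= => /andP[+ _]; apply: lt_trans; rewrite exprn_gt0.
have mB : measurable (@sqnorm R 1 @^-1` `]t1 ^+ 2, t2 ^+ 2]).
  by rewrite -[X in measurable X]setTI; exact: measurable_sqnorm.
rewrite -(has_density_standard gen (ltn0Sn 0) (expr1n _ _) mB).
have -> : (fun w => (1 * Defs.radius chi xi 1 w) *: U 1%N w) @^-1` (@sqnorm R 1 @^-1` `]t1 ^+ 2, t2 ^+ 2]) =
    [set w | V w \in `]t1, t2]] `|` [set w | - V w \in `]t1, t2]].
  apply/seteqP; split => w; rewrite /= sqnorm1 mxE mul1r -/(V w) !in_itv/=.
    move=> /andP[s1 s2].
    have [s0|s0] := leP 0 (V w); [left|right].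
      by rewrite -ltr_sqr ?nnegrE ?(ltW t10)// s1 -ler_sqr ?nnegrE ?(ltW t20).
    have ns0 : 0 <= - V w by lra.
    by rewrite -ltr_sqr ?nnegrE ?(ltW t10)// sqrrN s1 -ler_sqr ?nnegrE ?(ltW t20)// sqrrN.
  move=> [|] /andP[s1 s2].
    have s0 : 0 < V w by lra.
    by rewrite ltr_sqr ?nnegrE ?(ltW t10) ?(ltW s0)// s1 ler_sqr ?nnegrE ?(ltW s0) ?(ltW t20).
  have s0 : 0 < - V w by lra.
  by rewrite -(sqrrN (V w)) ltr_sqr ?nnegrE ?(ltW t10) ?(ltW s0)// s1 ler_sqr ?nnegrE ?(ltW s0) ?(ltW t20).
rewrite measureU; first last.
- apply/seteqP; split => // w [/=]; rewrite !in_itv/= => /andP[a _] /andP[b _].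
  lra.
- rewrite -[X in measurable X]setTI.
  have mNV : measurable_fun setT (fun w => - V w) by exact: measurableT_comp.
  exact: (mNV measurableT _ mI).
- exact: (mE _ mI).
rewrite [X in _ = (_ + X)%E](_ : _ = P [set w | V w \in `]t1, t2]]); last first.
  exact: (elliptical1N mI).
have -> : [set w | t1 < V w <= t2] = [set w | V w \in `]t1, t2]].
  by apply/funext => w /=; rewrite in_itv.
have : P [set w | V w \in `]t1, t2]] \is a fin_num by exact: fin_num_measure (mE _ mI).
have double (p : \bar R) : p \is a fin_num -> (2%:E * p = p + p)%E.
  by move=> pfin; rewrite -(fineK pfin) -EFinM -EFinD; congr EFin; ring.
exact: double.
Qed.

(** On the shell the radial density lies between its values at the two ends, and the shell has
    measure 2 (t2 - t1); the factor 2 cancels that of [elliptical1_itv]. This is the input of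
    [monotone_density]. *)
Lemma Phi_elliptical1_increment (t1 t2 : R) : 0 < t1 -> t1 <= t2 ->
  (t2 - t1) * h (t2 ^+ 2) <= Phi P V t2 - Phi P V t1 <= (t2 - t1) * h (t1 ^+ 2).
Proof.
move=> t10 t12; have t20 := lt_le_trans t10 t12.
have mV := measurable_elliptical1.
have mle t : measurable [set w | V w <= t].
  rewrite (_ : [set w | _] = V @^-1` `]-oo, t]); last first.
    by apply/funext => w /=; rewrite in_itv.
  by rewrite -[X in measurable X]setTI; exact: mV.
have mI : measurable [set w | t1 < V w <= t2].
  rewrite (_ : [set w | _] = V @^-1` `]t1, t2]); last first.
    by apply/funext => w /=; rewrite in_itv.
  by rewrite -[X in measurable X]setTI; exact: mV.
have Pfin B : measurable B -> P B \is a fin_num by move=> mB; exact: fin_num_measure.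
have -> : Phi P V t2 - Phi P V t1 = fine (P [set w | t1 < V w <= t2]).
  rewrite /Phi (_ : [set w | V w <= t2] = [set w | V w <= t1] `|` [set w | t1 < V w <= t2]).
    rewrite measureU ?fineD ?Pfin//; first by ring.
    by apply/seteqP; split => // w /= [a /andP[b _]]; lra.
  apply/seteqP; split => w /=.
    by have [a b|a b] := leP (V w) t1; [left|right].
  by move=> [a|/andP[]//]; exact: le_trans t12.
have fh u : 0 < u -> radial_density P xi 1 u \is a fin_num.
  by move=> u0; exact: radial_density_fin_num.
have t1s : 0 < t1 ^+ 2 by rewrite exprn_gt0.
have t2s : 0 < t2 ^+ 2 by rewrite exprn_gt0.
have mB : measurable (@sqnorm R 1 @^-1` `]t1 ^+ 2, t2 ^+ 2]).
  by rewrite -[X in measurable X]setTI; exact: measurable_sqnorm.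
have mrd : measurable_fun (@sqnorm R 1 @^-1` `]t1 ^+ 2, t2 ^+ 2])
    (fun z => radial_density P xi 1 (sqnorm z)).
  apply: measurable_funTS; apply: measurable_radial_density => //.
  exact: measurable_sqnorm.
set q := fine (P _).
have E : (2%:E * q%:E = \int[lebesgue_cV 1]_(z in @sqnorm R 1 @^-1` [set` `]t1 ^+ 2, t2 ^+ 2]%R])
    radial_density P xi 1 (sqnorm z))%E.
  by rewrite -(elliptical1_itv t10 t12) /q fineK ?Pfin.
have cstE (k : R) : (\int[lebesgue_cV 1]_(z in @sqnorm R 1 @^-1` [set` `]t1 ^+ 2, t2 ^+ 2]%R]) k%:E =
    k%:E * (2 * (t2 - t1))%:E)%E.
  have <- := lebesgue_cV1_shell t10 t12; exact: (integral_cst (lebesgue_cV 1) mB).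
have B1 : (2%:E * q%:E <=
    (h (t1 ^+ 2))%:E * (2 * (t2 - t1))%:E)%E.
  rewrite E -cstE; apply: ge0_le_integral => //.
  - by move=> z _; exact: radial_density_ge0.
  - move=> z /=; rewrite in_itv/= (fineK (fh _ t1s)) => /andP[/ltW s1 _].
    exact: radial_density_nonincreasing.
have B2 : ((h (t2 ^+ 2))%:E * (2 * (t2 - t1))%:E <=
    2%:E * q%:E)%E.
  rewrite E -cstE; apply: ge0_le_integral => //.
  - by move=> z _; rewrite lee_fin fine_ge0// radial_density_ge0.
  - move=> z /=; rewrite in_itv/= (fineK (fh _ t2s)) => /andP[_ s1].
    exact: radial_density_nonincreasing.
move: B1 B2; rewrite -!EFinM !lee_fin.
move: (fine (radial_density _ _ _ _)) (fine (radial_density _ _ _ _)) q E.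
by move=> p p' q _ B1 B2; apply/andP; split; lra.
Qed.

End one_dimensional_tail.

(** * Transfer of null sets under quadratic maps *)

Section signed_square.
Variable R : realType.
Local Notation leb := (@lebesgue_measure R).

Let integral_linear (k a b : R) : a < b ->
  (\int[leb]_(s in `[a, b]) (k * (2 * s))%:E = (k * (b ^+ 2 - a ^+ 2))%:E)%E.
Proof.
move=> ab.
have dF (s : R) : is_derive s 1 (fun y : R => k * y ^+ 2) (k * (2 * s)).
  have H : is_derive s 1 (fun y : R => y ^+ 2) (2 * s).
    by apply: is_derive_eq; rewrite /GRing.scale/=; ring.
  exact: is_deriveZ.
have cF (s : R) : k * y ^+ 2 @[y --> s] --> k * s ^+ 2.
  by apply: cvgMr; exact: exprn_continuous.
rewrite (@continuous_FTC2 _ _ (fun y => k * y ^+ 2))//.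
- by rewrite -EFinB; congr EFin; ring.
- apply: continuous_subspaceT => x.
  by apply: cvgMr; apply: cvgMr; exact: cvg_id.
- split.
  + by move=> x _; have [] := dF x.
  + exact: cvg_at_right_filter (cF _).
  + exact: cvg_at_left_filter (cF _).
- by move=> x _; rewrite derive1E; have [_ ->] := dF x.
Qed.

Lemma integral_norm2_itv (a b : R) : a <= b ->
  (\int[leb]_(s in `]a, b]) (2 * `|s|)%:E = (b * `|b| - a * `|a|)%:E)%E.
Proof.
have mf (A : set R) : measurable_fun A (fun s : R => (2 * `|s|)%:E).
  by apply/measurable_EFinP/measurable_funTS; apply: measurable_funM.
have pos (x y : R) : 0 <= x -> x < y ->
    (\int[leb]_(s in `]x, y]) (2 * `|s|)%:E = (y * `|y| - x * `|x|)%:E)%E.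
  move=> x0 xy; rewrite integral_itv_obnd_cbnd//.
  rewrite !ger0_norm ?(le_trans x0 (ltW xy))//.
  transitivity (\int[leb]_(s in `[x, y]) (1 * (2 * s))%:E)%E.
    apply: eq_integral => s; rewrite inE/= in_itv/= => /andP[xs _].
    by rewrite mul1r ger0_norm// (le_trans x0).
  by rewrite integral_linear// mul1r !expr2.
have neg (x y : R) : y <= 0 -> x < y ->
    (\int[leb]_(s in `]x, y]) (2 * `|s|)%:E = (y * `|y| - x * `|x|)%:E)%E.
  move=> y0 xy; rewrite integral_itv_obnd_cbnd//.
  rewrite !ler0_norm ?(le_trans (ltW xy) y0)//.
  transitivity (\int[leb]_(s in `[x, y]) (-1 * (2 * s))%:E)%E.
    apply: eq_integral => s; rewrite inE/= in_itv/= => /andP[_ sy].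
    by rewrite ler0_norm ?(le_trans sy)//; congr EFin; ring.
  by rewrite integral_linear//; congr EFin; ring.
rewrite le_eqVlt => /orP[/eqP <-|ab].
  by rewrite set_itvoc0 integral_set0 subrr.
have [a0|a0] := leP 0 a; first exact: pos.
have [b0|b0] := leP b 0; first exact: neg.
have -> : [set` `]a, b]] = `]a, 0] `|` `]0, b] :> set R.
  apply/seteqP; split => s /=; rewrite !in_itv/=.
    by move=> /andP[as_ sb]; have [s0|s0] := leP s 0; [left|right]; rewrite ?as_ ?sb.
  by move=> [] /andP[? ?]; apply/andP; split; lra.
rewrite ge0_integral_setU//; last 2 first.
- exact: mf.
- apply/disj_setPS => s [/=]; rewrite !in_itv/= => /andP[_ s0] /andP[s1 _]; lra.
transitivity ((0 * `|0 : R| - a * `|a|)%:E + (b * `|b| - 0 * `|0 : R|)%:E)%E.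
  exact: (f_equal2 (@adde R) (neg a 0 (lexx _) a0) (pos 0 b (lexx _) b0)).
by rewrite -EFinD; congr EFin; rewrite mul0r; ring.
Qed.

(** The map s |s| is an increasing bijection of the line with derivative 2 |s|, so the image of 2
    |s| ds agrees with Lebesgue measure on intervals. The plain square would not be injective. *)
Lemma lebesgue_signed_square (B : set R) : measurable B ->
  leb B = (\int[leb]_s ((2 * `|s|) * \1_B (s * `|s|))%:E)%E.
Proof.
have mf : measurable_fun setT (fun s : measurableTypeR R => 2 * s : R).
  exact: mulrl_measurable.
pose fmixin := isMeasurableFun.Build _ _ _ _ _ mf.
pose f : {mfun measurableTypeR R >-> R} := HB.pack (fun s : measurableTypeR R => 2 * s : R) fmixin.
pose psi (s : measurableTypeR R) : measurableTypeR R := s * `|s|.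
have mpsi : measurable_fun setT psi.
  by apply: measurable_funM.
pose nu0 : {measure set (measurableTypeR R) -> \bar R} := pushforward (density_measure leb f) psi.
pose nu := nu0 mpsi.
have psi_lt x y : (psi x < psi y) = (x < y).
  rewrite /psi; have [x0|x0] := leP 0 x; have [y0|y0] := leP 0 y.
  - by rewrite !ger0_norm// -!expr2 ltr_sqr.
  - rewrite (ger0_norm x0) (ltr0_norm y0); apply/idP/idP => ?; nra.
  - rewrite (ltr0_norm x0) (ger0_norm y0); apply/idP/idP => ?; nra.
  - rewrite (ltr0_norm x0) (ltr0_norm y0); apply/idP/idP => ?; nra.
have psi_surj u : exists x, psi x = u.
  have [u0|u0] := leP 0 u.
    exists (Num.sqrt u); rewrite /psi ger0_norm ?sqrtr_ge0//.
    by rewrite -expr2 sqr_sqrtr.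
  exists (- Num.sqrt (- u)); rewrite /psi normrN ger0_norm ?sqrtr_ge0// mulNr.
  by rewrite -expr2 sqr_sqrtr ?opprK// oppr_ge0 ltW.
move=> mB; transitivity (nu B).
  apply: lebesgue_measure_unique => //= _ [[a b]] _ <-.
  rewrite lebesgue_measure_itv/= lte_fin.
  have [x xa] := psi_surj a; have [y yb] := psi_surj b.
  have -> : nu [set` `]a, b]%R] = (\int[leb]_(s in `]x, y]) (2 * `|s|)%:E)%E.
    transitivity (\int[leb]_(s in psi @^-1` [set` `]a, b]%R]) (`|f s|)%:E)%E.
      by [].
    rewrite (_ : psi @^-1` _ = [set` `]x, y]]); last first.
      apply/seteqP; split => s; rewrite /= !in_itv/= -xa -yb psi_lt.
        by rewrite !leNgt psi_lt.
      by rewrite !leNgt psi_lt.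
    by apply: eq_integral => s _; rewrite /f/= normrM (ger0_norm (ler0n _ _)).
  case: ifPn => ab.
    rewrite integral_norm2_itv; last by rewrite ltW// -psi_lt xa yb.
    by rewrite -xa -yb.
  have yx : y <= x by rewrite leNgt -psi_lt xa yb.
  by rewrite set_itv_ge ?integral_set0// bnd_simp -leNgt.
transitivity (\int[leb]_(s in psi @^-1` B) (`|f s|)%:E)%E; first by [].
rewrite [LHS]integral_mkcond.
apply: eq_integral => s _; rewrite patchE indicE.
have -> : (s \in psi @^-1` B) = (s * `|s| \in B) by apply/idP/idP; rewrite !inE.
by case: ifP => _; rewrite /f/= ?mulr0// mulr1 normrM (ger0_norm (ler0n _ _)).
Qed.
End signed_square.

Section null_sets.
Variable R : realType.
Local Notation leb := (@lebesgue_measure R).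

Lemma lebesgue_measure_shift (k : R) (B : set R) : measurable B ->
  leb [set t | B (t + k)] = leb B.
Proof.
pose tau (t : measurableTypeR R) : measurableTypeR R := t + k.
have mtau : measurable_fun setT tau by exact: measurable_funD.
pose nu0 : {measure set (measurableTypeR R) -> \bar R} := pushforward leb tau.
move=> mB; apply/esym; transitivity (nu0 mtau B); last by [].
apply: lebesgue_measure_unique => //= _ [[a b]] _ <-.
transitivity (leb [set` `](a - k), (b - k)]]); last first.
  transitivity (leb (tau @^-1` [set` `]a, b]])); last by [].
  by congr (leb _); apply/seteqP; split => t; rewrite /= !in_itv/= ltrBlDr lerBrDr.
by rewrite !lebesgue_measure_itv/= !lte_fin ltrD2r -!EFinD; case: ifP => // _; congr EFin; ring.
Qed.

(** The density 2 |s| vanishes only at 0, so away from 0 null sets correspond in both directions. *)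
Let signed_square_null (B : set R) : measurable B ->
  leb B = 0%E <-> leb [set s | s != 0 /\ B (s * `|s|)] = 0%E.
Proof.
move=> mB.
have mpsi : measurable_fun setT (fun s : measurableTypeR R => s * `|s|) by exact: measurable_funM.
have mpB : measurable [set s | B (s * `|s|)].
  by rewrite -[X in measurable X]setTI; exact: (mpsi measurableT _ mB).
have mF : measurable_fun setT (fun s : measurableTypeR R => ((2 * `|s|) * \1_B (s * `|s|))%:E).
  apply/measurable_EFinP; apply: measurable_funM; first exact: measurable_funM.
  exact: (measurableT_comp (measurable_indic mB) mpsi).
have -> : [set s | s != 0 /\ B (s * `|s|)] = [set s : measurableTypeR R | ((2 * `|s|) * \1_B (s * `|s|))%:E != 0%E].
  apply/seteqP; split => s /=.
    by move=> [s0 Bs]; rewrite indicE mem_set// mulr1 eqe mulf_neq0// normr_eq0.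
  rewrite eqe mulf_eq0 negb_or mulf_eq0 negb_or normr_eq0 indicE => /andP[/andP[_ s0]].
  by case: (boolP (_ \in _)) => [/set_mem//|]; rewrite eqxx.
rewrite (lebesgue_signed_square mB).
have mN : measurable [set s : measurableTypeR R | ((2 * `|s|) * \1_B (s * `|s|))%:E != 0%E].
  have := measurable_neqe measurableT mF (measurable_cst (0%E : \bar R)).
  by rewrite setTI.
have E : (\int[leb]_s (2 * `|s| * \1_B (s * `|s|))%:E = \int[leb]_s `|(2 * `|s| * \1_B (s * `|s|))%:E|)%E.
  by apply: eq_integral => s _; rewrite gee0_abs// lee_fin !mulr_ge0.
rewrite E; split.
  move=> /(ae_eq_integral_abs leb measurableT mF) H.
  apply: measure_negligible => //; apply: negligibleS H => s /= Fs.
  by move=> /(_ I) F0; move: Fs; rewrite F0 eqxx.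
move=> N0; apply/(ae_eq_integral_abs leb measurableT mF).
exists [set s : measurableTypeR R | ((2 * `|s|) * \1_B (s * `|s|))%:E != 0%E]; split => //.
by move=> s /= /not_implyP[_ /eqP].
Qed.

(** Nullity passes from s to u = s^2, by translation from u + r to u + M, and back to t with u =
    t^2. The condition r <= M + T^2 ensures that every M + t^2 with t > T is of the form u + r with
    u > 0. *)
Lemma null_sqrD (N : set R) (r M T : R) : measurable N -> 0 < T ->
  r <= M + T ^+ 2 -> leb [set s | N (s ^+ 2 + r)] = 0%E ->
  leb [set t | T < t /\ N (M + t ^+ 2)] = 0%E.
Proof.
move=> mN T0 rM N0.
have preim (f : R -> R) (B : set R) : measurable_fun setT f -> measurable B -> measurable (f @^-1` B).
  by move=> mf mB; rewrite -[X in measurable X]setTI; exact: mf.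
have mNr k : measurable [set u : R | N (u + k)].
  by apply: (preim (fun u => u + k)) => //; exact: measurable_funD.
have gtE (a : R) : [set u | a < u] = `]a, +oo[%classic.
  by apply/funext => u /=; rewrite in_itv/= andbT.
have mgt (a : R) : measurable [set u | a < u] by rewrite gtE.
have msgn : measurable_fun setT (fun s : R => s * `|s|) by exact: measurable_funM.
have mneq0 : measurable [set s : R | s != 0].
  rewrite (_ : [set s | _] = ~` [set 0]); first exact: measurableC.
  by apply/seteqP; split => s /= /eqP.
pose B1 : set R := [set u | 0 < u] `&` [set u | N (u + r)].
have mB1 : measurable B1 by exact: measurableI.
have B10 : leb B1 = 0%E.
  apply/(signed_square_null mB1); apply: subset_measure0 N0.
  - by apply: measurableI => //; exact: preim.
  - apply: (preim (fun s => s ^+ 2 + r)) => //.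
    by apply: measurable_funD => //; exact: measurable_funX.
  move=> s /= [s0 [+ Ns]]; have [sp|sn] := ltP 0 s.
    by move: Ns; rewrite ger0_norm ?(ltW sp)// -expr2.
  by rewrite ler0_norm// ; rewrite mulrN /= oppr_gt0 -expr2 => sp; have := sqr_ge0 s; rewrite leNgt sp.
pose B1' : set R := [set v | T ^+ 2 + (M - r) < v] `&` [set u | N (u + r)].
have mB1' : measurable B1' by exact: measurableI.
have B1'0 : leb B1' = 0%E.
  by apply: subset_measure0 B10 => // v [/= v0 Nv]; split => //=; lra.
pose B2 : set R := [set t | B1' (t + (M - r))].
have mB2 : measurable B2 by apply: (preim (fun u => u + (M - r))) => //; exact: measurable_funD.
have B20 : leb B2 = 0%E by rewrite /B2 lebesgue_measure_shift.
have := (signed_square_null mB2).1 B20; apply: subset_measure0.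
- have mq : measurable_fun setT (fun s : R => M + s ^+ 2).
    by apply: measurable_funD => //; exact: measurable_funX.
  exact: (measurableI _ _ (mgt T) (preim _ _ mq mN)).
- by apply: measurableI => //; exact: preim.
move=> t [/= Tt Nt]; have t0 : 0 < t by lra.
split; first by rewrite gt_eqF.
rewrite ger0_norm ?(ltW t0)// -expr2 /B2/= /B1'; split => /=.
  by rewrite ltrD2r ltr_sqr ?nnegrE ?(ltW T0) ?(ltW t0).
by rewrite (_ : t ^+ 2 + (M - r) + r = M + t ^+ 2)//; ring.
Qed.

End null_sets.

(** * Tail of the conditional law *)

Section regular_tails.
Variable R : realType.
Local Notation leb := (@lebesgue_measure R).

(** Eventually f s lies between multiples of s^(-p) with constants close to [C], and the tail
    integral of s^(-p) is t^(1 - p) / (p - 1). *)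
Lemma integral_regular_tail (f : R -> R) (p C : R) : measurable_fun setT f ->
  (forall s, 0 <= f s) -> 1 < p -> 0 < C ->
  f s * s `^ p @[s --> +oo] --> C ->
  fine (\int[leb]_(s in `]t, +oo[) (f s)%:E) * t `^ (p - 1) @[t --> +oo] -->
    C * (p - 1)^-1.
Proof.
move=> mf f0 p1 C0 fC; have p10 : 0 < p - 1 by lra.
have mfE (A : set R) : measurable_fun A (fun s => (f s)%:E).
  by apply/measurable_EFinP/measurable_funTS.
have mpE (A : set R) (k : R) : measurable_fun A (fun s : R => (k * s `^ (- p))%:E).
  apply/measurable_EFinP/measurable_funTS; apply: measurable_funM => //.
have tailE (k t : R) : 0 <= k -> 0 < t ->
    (\int[leb]_(s in `]t, +oo[) (k * s `^ (- p))%:E = (k * (t `^ (1 - p) / (p - 1)))%:E)%E.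
  move=> k0 t0; rewrite integral_itv_obnd_cbnd//.
  under eq_integral do rewrite EFinM.
  rewrite ge0_integralZl_EFin//; last 2 first.
  - by move=> s _; rewrite lee_fin powR_ge0.
  - by apply/measurable_EFinP/measurable_funTS.
  by rewrite integral_powR_tail.
have up C1 : C < C1 -> \forall t \near +oo, (\int[leb]_(s in `]t, +oo[) (f s)%:E <=
    (C1 * (t `^ (1 - p) / (p - 1)))%:E)%E.
  move=> CC1; have C10 := lt_trans C0 CC1.
  have /near_pinftyP[T HT] : \forall s \near +oo, f s * s `^ p < C1 by apply: cvgr_lt fC _ _.
  apply/near_pinftyP; exists (Num.max 1 T) => t; rewrite ge_max => /andP[t1 Tt].
  have t0 : 0 < t by lra.
  rewrite -tailE ?(ltW C10)//; apply: ge0_le_integral => //.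
  - by move=> s _; rewrite lee_fin.
  - exact: mfE.
  - exact: mpE.
  - move=> s; rewrite /= in_itv/= andbT lee_fin => ts.
    have s0 := lt_trans t0 ts; rewrite powRN -ler_pdivrMr ?invr_gt0 ?powR_gt0// invrK.
    by rewrite ltW// HT// (le_trans Tt)// ltW.
have lo C1 : 0 < C1 -> C1 < C -> \forall t \near +oo, ((C1 * (t `^ (1 - p) / (p - 1)))%:E <=
    \int[leb]_(s in `]t, +oo[) (f s)%:E)%E.
  move=> C10 CC1.
  have /near_pinftyP[T HT] : \forall s \near +oo, C1 < f s * s `^ p by apply: cvgr_gt fC _ _.
  apply/near_pinftyP; exists (Num.max 1 T) => t; rewrite ge_max => /andP[t1 Tt].
  have t0 : 0 < t by lra.
  rewrite -tailE ?(ltW C10)//; apply: ge0_le_integral => //.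
  - by move=> s _; rewrite lee_fin mulr_ge0 ?powR_ge0 ?(ltW C10).
  - exact: mpE.
  - exact: mfE.
  - move=> s; rewrite /= in_itv/= andbT lee_fin => ts.
    have s0 := lt_trans t0 ts; rewrite powRN ler_pdivrMr ?powR_gt0//.
    by rewrite ltW// HT// (le_trans Tt)// ltW.
have fin : \forall t \near +oo, (\int[leb]_(s in `]t, +oo[) (f s)%:E)%E \is a fin_num.
  have := up (C + 1) (ltac:(by rewrite ltrDl)); apply: filterS => t H.
  rewrite ge0_fin_numE; first exact: le_lt_trans H (ltry _).
  by apply: integral_ge0 => s _; rewrite lee_fin.
have unpow (k t : R) : 0 < t -> k * (t `^ (1 - p) / (p - 1)) * t `^ (p - 1) = k / (p - 1).
  move=> t0; have : t `^ (1 - p) * t `^ (p - 1) = 1.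
    by rewrite -powRD ?(gt_eqF t0) ?implybT// (_ : 1 - p + (p - 1) = 0) ?powRr0//; ring.
  move=> E; have -> : k * (t `^ (1 - p) / (p - 1)) * t `^ (p - 1) =
      k / (p - 1) * (t `^ (1 - p) * t `^ (p - 1)) by ring.
  by rewrite E mulr1.
apply: squeeze_scaled_cvg; rewrite ?invr_gt0// => C1.
- move=> CC1; near=> t; have t0 : 0 < t by near: t; apply: nbhs_pinfty_gt; exact: num_real.
  rewrite -(unpow C1 t)// ler_wpM2r ?powR_ge0// -lee_fin fineK; last by near: t.
  by near: t; exact: up.
- move=> C10 CC1; near=> t; have t0 : 0 < t by near: t; apply: nbhs_pinfty_gt; exact: num_real.
  rewrite -(unpow C1 t)// ler_wpM2r ?powR_ge0// -lee_fin fineK; last by near: t.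
  by near: t; exact: lo.
Unshelve. all: by end_near. Qed.

End regular_tails.

Section conditional_density.
Context (R : realType) dO (Omega : measurableType dO) (P : probability Omega R).
Local Notation leb := (@lebesgue_measure R).
Variables (chi : nat -> {RV P >-> R}) (xi : {RV P >-> R})
  (U : forall d : nat, {RV P >-> 'cV[R]_d})
  (c : nat -> R) (g : nat -> R -> \bar R).
Hypotheses (model : radial_model chi xi U) (gen : density_generators chi xi U c g).

(** The standard elliptical vector has a density with respect to this measure, and a null measure
    could not give total probability 1. *)
Lemma lebesgue_cV_neq0 n : (0 < n)%N -> lebesgue_cV n (setT : set 'cV[R]_n) <> 0%E.
Proof.
move=> n0 L0.
have := has_density_standard gen n0 (expr1n _ _) measurableT.
rewrite preimage_setT probability_setT null_set_integral//.
  by move=> /eqP; rewrite onee_eq0.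
(* The generator is measurable on [0, +oo[, so it is extended by 0; squared norms do not see the
   difference. *)
pose g' : R -> \bar R := g n \_ `[0, +oo[.
have -> : (fun z : 'cV[R]_n => ((c n)%:E * g n (sqnorm z))%E) =
    (fun u : R => (c n)%:E * g' u)%E \o @sqnorm R n.
  apply/funext => z /=; rewrite /g' patchE mem_setE in_itv/= andbT.
  by rewrite sqnorm_ge0.
apply: measurableT_comp; last exact: measurable_sqnorm.
apply: measurable_funeM; apply/(measurable_restrictT _ _).1 => //.
exact: (generator_measurable gen n0).
Qed.

(* Sections of the null set where the generator and the radial density differ:
   by Fubini almost every one of them is null, and one is enough. *)
Lemma generator_section n : (0 < n)%N -> exists (N : set R) (r : R),
  [/\ measurable N, leb [set s | N (s ^+ 2 + r)] = 0%E &
    forall u, 0 < u -> ~ N u ->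
      ((c n.+1)%:E * g n.+1 u)%E = radial_density P xi n.+1 u].
Proof.
move=> n0; have [N [mN N0 NE]] := generator_ae model gen (ltn0Sn n).
exists N.
suff [r r0] : exists r, leb [set s | N (s ^+ 2 + r)] = 0%E by exists r.
pose E : set (measurableTypeR R * 'cV[R]_n) := [set p | N (p.1 ^+ 2 + sqnorm p.2)].
have mq : measurable_fun setT (fun p : measurableTypeR R * 'cV[R]_n => p.1 ^+ 2 + sqnorm p.2).
  apply: measurable_funD; first by apply: measurable_funX; exact: measurable_fst.
  exact: (measurableT_comp (@measurable_sqnorm R n) measurable_snd).
have mE : measurable E.
  by rewrite -[X in measurable X]setTI; exact: (mq measurableT _ mN).
have E0 : (leb \x lebesgue_cV n)%E E = 0%E.
  rewrite -N0 /lebesgue_cV/= /cons_measure/= /pushforward; congr (_ _).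
  by apply/seteqP; split => -[s v]; rewrite /E/= sqnorm_cons.
have mI : measurable_fun setT (fun p => (\1_E p)%:E : \bar R).
  by apply/measurable_EFinP; exact: measurable_indic.
have I0 p : (0 <= (\1_E p)%:E :> \bar R)%E by rewrite lee_fin.
have mG := measurable_fun_fubini_tonelli_G (m1 := leb) _ mI I0.
have : (\int[lebesgue_cV n]_v \int[leb]_s (\1_E (s, v))%:E = 0)%E.
  rewrite -(fubini_tonelli2 (m1 := leb) _ mI I0) integral_indic// setIT.
  exact: E0.
move=> G0.
have : (\int[lebesgue_cV n]_v `|\int[leb]_s (\1_E (s, v))%:E| = 0)%E.
  rewrite -[RHS]G0; apply: eq_integral => v _.
  by rewrite gee0_abs//; apply: integral_ge0 => s _; exact: I0.
move=> /(ae_eq_integral_abs _ measurableT mG)[B [mB B0 BE]].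
have [v Bv] : exists v, ~ B v.
  apply/existsNP => HB; apply: (lebesgue_cV_neq0 n0).
  by rewrite -B0; congr (_ _); apply/seteqP; split => // v _; exact: HB.
exists (sqnorm v).
have := contrapT (contra_not (BE v) Bv) => /(_ I).
rewrite /fubini_G/= => <-.
pose Ev : set (measurableTypeR R) := [set s | N (s ^+ 2 + sqnorm v)].
have mEv : measurable Ev.
  rewrite -[X in measurable X]setTI.
  have : measurable_fun setT (fun s : measurableTypeR R => s ^+ 2 + sqnorm v).
    by apply: measurable_funD => //; exact: measurable_funX.
  by move=> /(_ measurableT _ mN).
transitivity (\int[leb]_s (\1_Ev s)%:E)%E; first by rewrite integral_indic// setIT.
by apply: eq_integral => s _; rewrite !indicE; congr ((nat_of_bool _)%:R)%:E.
Qed.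

End conditional_density.

Section distribution_function.
Context (R : realType) dO (Omega : measurableType dO) (P : probability Omega R).
Variable V : Omega -> R.
Hypothesis mV : measurable_fun setT V.

Let Vmixin := isMeasurableFun.Build _ _ _ _ _ mV.
Let W : {RV P >-> R} := HB.pack V Vmixin.

Lemma PhiE t : Phi P V t = fine (cdf W t).
Proof.
by rewrite /Phi /cdf /distribution /pushforward; congr (fine (P _)).
Qed.

Let cdf_fin t : cdf W t \is a fin_num.
Proof. by rewrite /cdf fin_num_measure. Qed.

Lemma Phi_homo : {homo Phi P V : s t / s <= t}.
Proof.
by move=> s t st; rewrite !PhiE fine_le//; exact: cdf_nondecreasing.
Qed.

Lemma cvg_PhiNy : Phi P V t @[t --> -oo] --> (0 : R).
Proof.
have -> : Phi P V = fine \o cdf W by apply/funext => t; rewrite PhiE.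
by apply: fine_cvg; exact: cvg_cdfNy0.
Qed.

Lemma cvg_Phiy : Phi P V t @[t --> +oo] --> (1 : R).
Proof.
have -> : Phi P V = fine \o cdf W by apply/funext => t; rewrite PhiE.
by apply: fine_cvg; exact: cvg_cdfy1.
Qed.

Lemma onem_Phi t : 1 - Phi P V t = fine (P (V @^-1` `]t, +oo[)).
Proof.
have mB : measurable (V @^-1` `]-oo, t]) by rewrite -[X in measurable X]setTI; exact: mV.
have -> : V @^-1` `]t, +oo[ = ~` (V @^-1` `]-oo, t]).
  by apply/seteqP; split => w /=; rewrite !in_itv/= andbT ltNge => /negP.
have Pfin : P (V @^-1` `]-oo, t]) \is a fin_num by exact: fin_num_measure.
by rewrite probability_setC// -(fineK Pfin).
Qed.

End distribution_function.

Section conditional_tail.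
Context (R : realType) dO (Omega : measurableType dO) (P : probability Omega R).
Local Notation leb := (@lebesgue_measure R).
Variables (chi : nat -> {RV P >-> R}) (xi : {RV P >-> R})
  (U : forall d : nat, {RV P >-> 'cV[R]_d})
  (c : nat -> R) (g : nat -> R -> \bar R).
Hypotheses (model : radial_model chi xi U) (gen : density_generators chi xi U c g).

(** For large t the points M + s^2 with s > t are positive and beyond [r], so [null_sqrD] applies to
    the exceptional set and the radial density may replace the generator under the integral. *)
Lemma conditional_tailE n (M K : R) (V : Omega -> R) : (0 < n)%N -> 0 < K ->
  measurable_fun setT V ->
  has_density P V leb
    (fun t : R => (c n.+1)%:E * g n.+1 (M + t ^+ 2)%R * (K^-1)%:E)%E ->
  \forall t \near +oo, 1 - Phi P V t =
    fine (\int[leb]_(s in `]t, +oo[)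
      (fine (radial_density P xi n.+1 (M + s ^+ 2)) * K^-1)%:E)%E.
Proof.
move=> n0 K0 mV dens.
have [N [r [mN N0 NE]]] := generator_section model gen n0.
near=> t.
have t0 : 0 < t by near: t; apply: nbhs_pinfty_gt; exact: num_real.
have t1 : 1 <= t by near: t; apply: nbhs_pinfty_ge; exact: num_real.
(* Together with t <= t^2, this puts M + t^2 above both [r] and 0. *)
have tr : Num.max r 0 - M + 1 <= t by near: t; apply: nbhs_pinfty_ge; exact: num_real.
have tt : t <= t ^+ 2 by rewrite expr2; nra.
have rM : r <= M + t ^+ 2.
  have : r <= Num.max r 0 by rewrite le_max lexx.
  lra.
have M0 : 0 < M + t ^+ 2.
  have : 0 <= Num.max r 0 by rewrite le_max lexx orbT.
  lra.
have Ms s : t < s -> 0 < M + s ^+ 2.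
  move=> ts; apply: (lt_trans M0); rewrite ltrD2l ltr_sqr// ?nnegrE ?(ltW t0)//.
  by rewrite ltW// (lt_trans t0).
rewrite onem_Phi//; congr fine.
have mq : measurable_fun setT (fun s : measurableTypeR R => M + s ^+ 2).
  by apply: measurable_funD => //; exact: measurable_funX.
have h0 u : 0 <= fine (radial_density P xi n.+1 u) by rewrite fine_ge0// radial_density_ge0.
have mh : measurable_fun setT (fun s : measurableTypeR R =>
    (fine (radial_density P xi n.+1 (M + s ^+ 2)) * K^-1)%:E).
  apply/measurable_EFinP; apply: measurable_funM => //.
  apply: (measurableT_comp (fine_measurable measurableT)).
  by apply: measurable_radial_density.
pose g' : R -> \bar R := g n.+1 \_ `[0, +oo[.
have mg' : measurable_fun setT g'.
  apply/(measurable_restrictT _ _).1 => //; exact: (generator_measurable gen (ltn0Sn n)).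
have gE s : t < s -> g n.+1 (M + s ^+ 2) = g' (M + s ^+ 2).
  by move=> ts; rewrite /g' patchE mem_setE in_itv/= andbT ltW ?Ms.
pose G (s : R) : \bar R := ((c n.+1)%:E * g n.+1 (M + s ^+ 2)%R * (K^-1)%:E)%E.
pose G' (s : R) : \bar R := ((c n.+1)%:E * g' (M + s ^+ 2)%R * (K^-1)%:E)%E.
have GE : {in `]t, +oo[%classic, G' =1 G}.
  by move=> s /[!inE]/=; rewrite in_itv/= andbT => /gE E; rewrite /G /G' E.
have mq' : measurable_fun setT (fun s : R => M + s ^+ 2).
  by apply: measurable_funD => //; exact: measurable_funX.
have mG : measurable_fun (`]t, +oo[ : set R) G.
  apply: (eq_measurable_fun G') => //.
  apply: measurable_funTS; apply: emeasurable_funM => //.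
  apply: measurable_funeM; exact: (measurableT_comp mg' mq').
have G0 s : t < s -> (0 <= G s)%E.
  move=> ts; rewrite /G !mule_ge0 ?lee_fin ?invr_ge0 ?(ltW K0)//.
    by rewrite ltW// (generator_coef gen (ltn0Sn n)).
  by apply: (generator_ge0 gen (ltn0Sn n)); rewrite ltW// Ms.
(* R carries two measurable structures with the same measurable sets, the
   canonical one and measurableTypeR R; this moves between them. *)
have mid : measurable_fun [set: measurableTypeR R] (fun s : measurableTypeR R => s : R).
  exact: measurable_id.
have dE : P (V @^-1` `]t, +oo[) = (\int[leb]_(s in `]t, +oo[) (G s))%E.
  rewrite dens//; apply: (ge0_integral_pushforward mid leb _ mG) => //.
  by move=> s /[!inE]/=; rewrite in_itv/= andbT; exact: G0.
rewrite dE; transitivity (\int[leb]_(s in `]t, +oo[) G' s)%E.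
  by apply: eq_integral => s /GE.
apply: ae_eq_integral => //.
- apply: measurable_funTS; apply: emeasurable_funM => //.
  apply: measurable_funeM; exact: (measurableT_comp mg' mq).
- exact: measurable_funTS.
exists [set s | t < s /\ N (M + s ^+ 2)]; split.
- have -> : [set s | t < s /\ N (M + s ^+ 2)] = `]t, +oo[ `&` ((fun s : R => M + s ^+ 2) @^-1` N).
    by apply/seteqP; split => s /=; rewrite in_itv/= andbT.
  by apply: measurableI => //; rewrite -[X in measurable X]setTI; exact: mq.
- exact: null_sqrD rM N0.
- move=> s /= /not_implyP[]; rewrite in_itv/= andbT => ts neq; split => //.
  apply: contrapT => Ns; apply: neq.
  rewrite /G' -gE// NE ?Ms// EFinM fineK//.
  by apply: radial_density_fin_num => //; exact: Ms.
Unshelve. all: by end_near. Qed.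

(** The power s^(2q) is (M + s^2)^q times (1 - M / (M + s^2))^q, and the last factor tends to 1. *)
Lemma cvg_add_sqr (f : R -> R) (M q C : R) :
  f u * u `^ q @[u --> +oo] --> C ->
  f (M + s ^+ 2) * s `^ (2 * q) @[s --> +oo] --> C.
Proof.
move=> fC.
have nearMs (Q : R -> Prop) : (\forall u \near +oo, Q u) -> \forall s \near +oo, Q (M + s ^+ 2).
  move=> /near_pinftyP[T TQ]; apply/near_pinftyP; exists (Num.max 1 (T - M)) => s.
  rewrite ge_max => /andP[s1 Ts]; apply: TQ.
  have : s <= s ^+ 2 by rewrite expr2; nra.
  lra.
have H1 : f (M + s ^+ 2) * (M + s ^+ 2) `^ q @[s --> +oo] --> C.
  by apply: cvg_trans fC => B; exact: nearMs.
have H2 : 1 - M / (M + s ^+ 2) @[s --> +oo] --> (1 : R).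
  rewrite -[X in _ --> X]subr0; apply: cvgB; first exact: cvg_cst.
  rewrite -(mulr0 M); apply: cvgMr.
  apply/cvgrPdist_le => e e0; near=> s.
  rewrite sub0r normrN.
  have : e^-1 <= M + s ^+ 2.
    near: s; apply: (nearMs (fun u => e^-1 <= u)).
    by apply: nbhs_pinfty_ge; exact: num_real.
  move=> H; have e1 : 0 < e^-1 by rewrite invr_gt0.
  have Ms := lt_le_trans e1 H.
  rewrite gtr0_norm ?invr_gt0// -[leRHS]invrK lef_pV2// posrE.
have H3 : (1 - M / (M + s ^+ 2)) `^ q @[s --> +oo] --> (1 : R).
  have e : 1 = 1 `^ q :> R by rewrite powR1.
  rewrite [X in _ --> X]e.
  exact: (cvg_comp _ _ H2 (continuous_powR_gt0 (a := q) ltr01)).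
rewrite -[C]mulr1; apply: cvg_near_eq (cvgM H1 H3).
near=> s.
have s0 : 0 < s by near: s; apply: nbhs_pinfty_gt; exact: num_real.
have Ms : 0 < M + s ^+ 2.
  near: s; apply: (nearMs (fun u => 0 < u)).
  by apply: nbhs_pinfty_gt; exact: num_real.
rewrite /=; have -> : 1 - M / (M + s ^+ 2) = s ^+ 2 / (M + s ^+ 2) by field; rewrite gt_eqF.
rewrite -mulrA; congr (_ * _); rewrite -powRM ?divr_ge0 ?sqr_ge0 ?(ltW Ms)//.
rewrite mulrC divfK ?gt_eqF// powRrM; congr (_ `^ _).
by rewrite -powR_mulrn ?(ltW s0).
Unshelve. all: by end_near. Qed.

End conditional_tail.

(** * The ratio of the two tails *)

Theorem proposition2p2 (R : realType) (N : nat)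
  (dO : measure_display) (Omega : measurableType dO) (P : probability Omega R)
  (chi : nat -> {RV P >-> R}) (xi : {RV P >-> R})
  (U : forall d : nat, {RV P >-> 'cV[R]_d})
  (c : nat -> R) (g : nat -> R -> \bar R)
  (X : {RV P >-> 'cV[R]_N}) (Y : {RV P >-> R})
  (muX : 'cV[R]_N) (muY : R)
  (SX : 'M[R]_N) (SXY : 'cV[R]_N) (SY : R)
  (x : 'cV[R]_N) (Rs : {RV P >-> R})
  (gamma rho : R) (A : R -> R) :
  (0 < N)%N ->
  radial_model chi xi U ->
  density_generators chi xi U c g ->
  (* (X, Y) is (xi, N + 1)-elliptical, with positive definite Sigma *)
  posdefmx (joint_scatter SX SXY SY) ->
  elliptical chi xi U (joint_mean muX muY) (joint_scatter SX SXY SY)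
    (fun w => col_mx (X w) (Y w)%:M) ->
  (* conditioning point *)
  (0 < (c N)%:E * g N (mahalanobis muX SX x) < +oo)%E ->
  (* R* *)
  (forall w, 0 <= Rs w) ->
  independent2 P Rs (U 1%N) ->
  has_density P (fun w => Rs w * U 1%N w ord0 ord0) lebesgue_measure
    (fun t : R => (c N.+1)%:E * g N.+1 (mahalanobis muX SX x + t ^+ 2)%R *
      ((fine ((c N)%:E * g N (mahalanobis muX SX x)))^-1)%:E)%E ->
  has_density P
    (fun w => cond_mean muX muY SX SXY x +
      cond_scale SX SXY SY * (Rs w * U 1%N w ord0 ord0)) lebesgue_measure
    (cond_density muX muY SX SXY SY c g x) ->
  (* second-order condition on Phi_R *)
  0 < gamma -> rho < 0 ->
  A t @[t --> +oo] --> 0 ->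
  (forall omega : R, 0 < omega ->
    (A t)^-1 *
      (quantile (Phi P (elliptical1 chi xi U)) (1 - (omega * t)^-1) /
       quantile (Phi P (elliptical1 chi xi U)) (1 - t^-1) - omega `^ gamma)
    @[t --> +oo] --> omega `^ gamma * ((omega `^ rho - 1) / rho)) ->
  exists eta l : R,
    [/\ 0 < l,
        (1 - Phi P (fun w => Rs w * U 1%N w ord0 ord0) t) /
          (1 - Phi P (elliptical1 chi xi U) (t `^ eta))
          @[t --> +oo] --> l,
        eta = 1 + gamma * N%:R &
        l = Gamma ((N%:R + gamma^-1 + 1) / 2) / Gamma ((gamma^-1 + 1) / 2) *
            (gamma^-1 * pi `^ (- (N%:R / 2)) /
             ((N%:R + gamma^-1) *
              fine ((c N)%:E * g N (mahalanobis muX SX x))%E))].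
Proof.
move=> N0 model gen _ _ /andP[K0 Ky] _ _ dens _ g0 r0 A0 Hq.
set Mx := mahalanobis muX SX x in K0 Ky dens *.
set K := fine _ in dens *.
have {K0 Ky}K0 : 0 < K by rewrite /K fine_gt0// K0.
set V := elliptical1 chi xi U in Hq *.
have mV : measurable_fun setT V := measurable_elliptical1 _ _ _.
set al := gamma^-1; have al0 : 0 < al by rewrite invr_gt0.
have Fm := Phi_homo P mV.
have FNy := cvg_PhiNy P mV.
have Fy := cvg_Phiy P mV.
have mxi : measurable_fun setT xi by [].
have [lam l0 Hlam] : exists2 lam : R, 0 < lam &
    quantile (Phi P V) (1 - t^-1) * t `^ (- gamma) @[t --> +oo] --> lam.
  (* Arguments above 1 keep the levels 1 - 1/s inside ]0, 1[, where the quantile function is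
     monotone. *)
  apply: (second_order_power g0 r0 _ A0 Hq) => s t s1 st.
  have s0 : 0 < s by lra.
  have t0 : 0 < t by lra.
  have sV : s^-1 < 1 by rewrite invf_lt1.
  have tV : 0 < t^-1 by rewrite invr_gt0.
  apply: (quantile_homo FNy Fy); first by rewrite subr_gt0.
    by rewrite lerD2l lerN2 lef_pV2 ?posrE.
  by rewrite gtrBl.
have Ftail := quantile_power_tail Fm FNy Fy g0 l0 Hlam.
rewrite -/al in Ftail; set L := lam `^ al in Ftail.
have L0 : 0 < L by rewrite powR_gt0.
pose h n u := fine (radial_density P xi n u).
have h1tail : h 1 (t ^+ 2) * t `^ (al + 1) @[t --> +oo] --> L * al.
  apply: (monotone_density (F := fun t => 1 - Phi P V t) (T := 0)) Ftail.
  move=> u v u0 uv; have := Phi_elliptical1_increment model gen u0 uv.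
  by rewrite -/V /h => /andP[H1 H2]; apply/andP; split; lra.
have mS := measurable_precision mxi.
have fin a u : 0 < a -> 0 < u -> laplace_moment P (precision xi) a u \is a fin_num.
  by move=> a0 u0; exact: laplace_moment_fin_num.
have hE n u : (0 < n)%N -> 0 < u -> h n u =
    pi `^ (- (n%:R / 2)) * fine (laplace_moment P (precision xi) (n%:R / 2) u).
  move=> n0 u0; rewrite /h /radial_density fineM// fin//.
  by rewrite divr_gt0// ltr0n.
(* The decay exponent al + 1 in t, read in the variable u = t^2. *)
set b := (al + 1) / 2; have b0 : 0 < b by rewrite divr_gt0// addr_gt0.
have pi0 : 0 < pi :> R := pi_gt0 R.
have Htail : fine (laplace_moment P (precision xi) (1%:R / 2) u) * u `^ b @[u --> +oo]
    --> L * al * pi `^ (1%:R / 2).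
  have H : h 1 ((u `^ 2^-1) ^+ 2) * (u `^ 2^-1) `^ (al + 1) @[u --> +oo] --> L * al.
    by apply: cvg_trans h1tail => B; exact: near_pinfty_powR.
  apply: cvg_near_eq (cvgMl H); near=> u.
  have u0 : 0 < u by near: u; apply: nbhs_pinfty_gt; exact: num_real.
  have -> : (u `^ 2^-1) ^+ 2 = u by rewrite powR12_sqrt ?(ltW u0)// sqr_sqrtr ?(ltW u0).
  rewrite hE// -powRrM (_ : 2^-1 * (al + 1) = b); last by rewrite /b mulrC.
  rewrite powRN; have pn0 : pi `^ (1%:R / 2) != 0 :> R by rewrite gt_eqF// powR_gt0.
  by field.
have C0 : 0 < L * al * pi `^ (1%:R / 2) by rewrite !mulr_gt0// powR_gt0.
have a0 : 0 < 1%:R / 2 :> R by rewrite divr_gt0.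
have shift := laplace_moment_half_shift (n := N) mS fin a0 b0 C0 Htail.
have bN : b + N%:R / 2 = (N%:R + al + 1) / 2 by rewrite /b; field.
have Gb := Gamma_gt0 b0.
have bN0 : 0 < b + N%:R / 2 by rewrite ltr_wpDr// divr_ge0.
have GbN := Gamma_gt0 bN0.
set G := Gamma (b + N%:R / 2) / Gamma b in shift.
have G0 : 0 < G by rewrite divr_gt0.
(* The power 1/2 undoes the normalization of h_1, the power -(N + 1)/2 is that of h_(N+1). *)
have piE : pi `^ (- (N.+1%:R / 2)) * pi `^ (1%:R / 2) = pi `^ (- (N%:R / 2)) :> R.
  rewrite -powRD ?(gt_eqF pi0) ?implybT//; congr (_ `^ _).
  by rewrite -natr1; field.
have hN : h N.+1 u * u `^ (b + N%:R / 2) @[u --> +oo] -->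
    L * al * pi `^ (- (N%:R / 2)) * G.
  have -> : L * al * pi `^ (- (N%:R / 2)) * G =
      pi `^ (- (N.+1%:R / 2)) * (L * al * pi `^ (1%:R / 2) * G) by rewrite -piE; ring.
  apply: cvg_near_eq (cvgMr shift); near=> u.
  have u0 : 0 < u by near: u; apply: nbhs_pinfty_gt; exact: num_real.
  rewrite hE// (_ : N.+1%:R / 2 = 1%:R / 2 + N%:R / 2) ?mulrA//.
  by rewrite -natr1; field.
set C := L * al * _ * _ in hN.
have piN0 : 0 < pi `^ (- (N%:R / 2)) :> R by rewrite powR_gt0.
have CC0 : 0 < C := mulr_gt0 (mulr_gt0 (mulr_gt0 L0 al0) piN0) G0.
(* The decay exponent of h_(N+1) (M + s^2) in s; one power is lost when integrating the tail, which
   leaves N + al. *)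
set p := 2 * (b + N%:R / 2).
have pE : p - 1 = N%:R + al by rewrite /p /b; field.
have N1 : 0 <= N%:R :> R by rewrite ler0n.
have p1 : 1 < p by rewrite -subr_gt0 pE; lra.
have mq : measurable_fun setT (fun s : measurableTypeR R => Mx + s ^+ 2).
  by apply: measurable_funD => //; exact: measurable_funX.
have ftail := integral_regular_tail (f := fun s => h N.+1 (Mx + s ^+ 2) * K^-1) (p := p)
  (C := C * K^-1) _ _ p1 _ _.
set VR := fun w => Rs w * U 1%N w ord0 ord0 in dens *.
have mVR : measurable_fun setT VR.
  apply: measurable_funM => //.
  exact: (measurableT_comp (measurable_coord ord0 ord0) (measurable_funP (U 1%N))).
have condE := conditional_tailE model gen N0 K0 mVR dens.
have Rtail : (1 - Phi P VR t) * t `^ (p - 1) @[t --> +oo] --> C * K^-1 * (p - 1)^-1.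
  apply: cvg_near_eq (ftail _ _ _ _).
  - by apply: filterS condE => t ->.
  - apply: measurable_funM => //.
    apply: (measurableT_comp (fine_measurable measurableT)).
    exact: measurable_radial_density.
  - move=> s; rewrite mulr_ge0 ?invr_ge0 ?(ltW K0)// /h fine_ge0//.
    exact: radial_density_ge0.
  - by rewrite mulr_gt0 ?invr_gt0.
  - have H := cvg_add_sqr Mx hN.
    apply: cvg_near_eq (cvgMl H).
    by near=> s; rewrite /p; ring.
(* Chosen so that eta times al is N + al: both tails are then of order t^(-(N + al)). *)
set eta := 1 + gamma * N%:R.
have eta0 : 0 < eta by rewrite ltr_pwDl// mulr_ge0// ltW.
have etaE : eta * al = p - 1.
  by rewrite pE /eta /al; field; rewrite gt_eqF.
have Fe : (1 - Phi P V (t `^ eta)) * (t `^ eta) `^ al @[t --> +oo] --> L.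
  by apply: cvg_trans Ftail => B; exact: near_pinfty_powR.
exists eta, (G * (al * pi `^ (- (N%:R / 2)) / ((N%:R + al) * K))).
have Na0 : 0 < N%:R + al by lra.
split => //; last by rewrite /G bN.
  exact: mulr_gt0 G0 (divr_gt0 (mulr_gt0 al0 piN0) (mulr_gt0 Na0 K0)).
(* [C] carries the factor [L], the constant of the tail of [Phi P V], which the denominator
   removes. *)
have -> : G * (al * pi `^ (- (N%:R / 2)) / ((N%:R + al) * K)) =
    C * K^-1 * (p - 1)^-1 * L^-1.
  by rewrite pE /C; field; rewrite !gt_eqF.
apply: cvg_near_eq (cvgM Rtail (cvgV (lt0r_neq0 L0) Fe)).
near=> t; have t0 : 0 < t by near: t; apply: nbhs_pinfty_gt; exact: num_real.
rewrite /= -powRrM etaE invfM.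
have tp : t `^ (p - 1) != 0 by rewrite gt_eqF// powR_gt0.
by rewrite mulrACA divff ?mulr1.
Unshelve. all: by end_near. Qed.
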